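(* Let $p\ge5$ be a prime, $n\ge3$ and $k\ge0$ integers. Then the group $\mathrm{SL}_n(\mathbb F_p[t_1,\dots,t_k])$ has Kazhdan property (T).
   Context: $\mathbb F_p[t_1,\dots,t_k]$ is the commutative polynomial ring over the field with $p$ elements. A finitely generated discrete group $G$ has Kazhdan property (T) if for some (equivalently any) finite generating set $S$ the Kazhdan constant $\kappa(G,S)$ is positive, where $\kappa(G,S)$ is the supremum of $\varepsilon\ge0$ such that every unitary representation of $G$ containing a unit vector $v$ with $\|g v-v\|\le\varepsilon$ for all $g\in S$ contains a nonzero $G$-invariant vector. *)

(* Defs.v *)
From HB Require Import structures.
From mathcomp Require Import all_boot all_order all_algebra.
From mathcomp Require Import complex.
From mathcomp Require Import Rstruct.
From mathcomp Require Import mpoly.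
From Stdlib Require Import List.

Set Implicit Arguments.
Unset Strict Implicit.
Unset Printing Implicit Defensive.

Import Order.TTheory GRing.Theory Num.Theory.
Local Open Scope ring_scope.

Notation RR := Rdefinitions.R.
Notation CC := (complex RR).

Definition is_inner_product (V : lmodType CC) (dot : V -> V -> CC) : Prop :=
  [/\ (forall (a : CC) (u v w : V), dot (a *: u + v) w = a * dot u w + dot v w),
      (forall u v : V, dot v u = conjc (dot u v)),
      (forall u : V, 0 <= complex.Re (dot u u)) &
      (forall u : V, dot u u = 0 -> u = 0)].

Definition ip_norm (V : lmodType CC) (dot : V -> V -> CC) (u : V) : RR :=
  Num.sqrt (complex.Re (dot u u)).

Definition ip_complete (V : lmodType CC) (dot : V -> V -> CC) : Prop :=
  forall u : nat -> V,
    (forall e : RR, 0 < e -> exists N : nat, forall m n : nat,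
        (N <= m)%N -> (N <= n)%N -> ip_norm dot (u m - u n) < e) ->
    exists l : V, forall e : RR, 0 < e -> exists N : nat, forall n : nat,
        (N <= n)%N -> ip_norm dot (u n - l) < e.

Record hilbertSpace := HilbertSpace {
  hs_car :> lmodType CC;
  hs_dot : hs_car -> hs_car -> CC;
  hs_inner : is_inner_product hs_dot;
  hs_complete : ip_complete hs_dot
}.

Definition hnorm (H : hilbertSpace) (u : H) : RR := ip_norm (@hs_dot H) u.

(* Groups given as a subset G (predicate inG) of a type T closed under  *)
(* mul / one / inv.                                                     *)

Definition unitary_op (H : hilbertSpace) (f : H -> H) : Prop :=
  [/\ (forall (a : CC) (u v : H), f (a *: u + v) = a *: f u + f v),
      (forall u v : H, hs_dot (f u) (f v) = hs_dot u v) &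
      (forall w : H, exists u : H, f u = w)].

Definition unitary_rep (T : Type) (inG : T -> Prop) (mul : T -> T -> T) (one : T)
    (H : hilbertSpace) (pi : T -> H -> H) : Prop :=
  [/\ (forall g, inG g -> unitary_op (pi g)),
      (forall g h, inG g -> inG h -> forall v, pi (mul g h) v = pi g (pi h v)) &
      (forall v, pi one v = v)].

Definition generates (T : Type) (inG : T -> Prop) (mul : T -> T -> T) (one : T)
    (inv : T -> T) (S : list T) : Prop :=
  (forall s, In s S -> inG s) /\
  forall g, inG g -> exists w : list (bool * T),
    (forall x, In x w -> In (snd x) S) /\
    g = fold_right (fun x acc => mul (if fst x then snd x else inv (snd x)) acc) one w.

(* eps belongs to the set whose supremum is the Kazhdan constant kappa(G,S):
   every unitary representation with a unit vector v such that
   ||g v - v|| <= eps for all g in S has a nonzero G-invariant vector. *)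
Definition kazhdan_eps (T : Type) (inG : T -> Prop) (mul : T -> T -> T) (one : T)
    (S : list T) (eps : RR) : Prop :=
  forall (H : hilbertSpace) (pi : T -> H -> H),
    unitary_rep inG mul one pi ->
    forall v : H, hnorm v = 1 ->
      (forall s, In s S -> hnorm (pi s v - v) <= eps) ->
      exists w : H, w <> 0 /\ forall g, inG g -> pi g w = w.

(* Kazhdan property (T): G is finitely generated and for some finite
   generating set S the Kazhdan constant kappa(G,S) = sup {eps >= 0 | ...}
   is positive, i.e. some eps > 0 is in that (downward closed) set. *)
Definition property_T (T : Type) (inG : T -> Prop) (mul : T -> T -> T) (one : T)
    (inv : T -> T) : Prop :=
  exists S : list T, generates inG mul one inv S /\
    exists eps : RR, 0 < eps /\ kazhdan_eps inG mul one S eps.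

Definition inSL (p n k : nat) (M : 'M[{mpoly 'F_p[k]}]_n) : Prop := \det M = 1.

(* Main.v *)
(** Two independent facts are combined.

    Spectral gap.  The group E_n(F_p[t_1..t_k]) of elementary matrices is generated by the n
    finite subgroups e_{i,i+1}(F_p) for i < n, and e_{n,1}(F_p + F_p t_1 + .. + F_p t_k).
    Cyclically adjacent ones generate a Heisenberg group, in which the angle between the two
    spaces of invariant vectors has cosine at most c = p^(-1/2); the others commute.  With
    Q_i the projection onto the orthogonal of the vectors invariant under the i-th subgroup
    and D the sum of the Q_i, this gives D^2 >= (1 - 2c) D, and 2c < 1 exactly when p >= 5.
    Gradient descent along D then moves an almost invariant vector to a nearby invariant one.

    Suslin's stability theorem: SL_n(F[t_1..t_k]) = E_n(F[t_1..t_k]) for n >= 3.  By induction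
    on k; for X over R[x], Quillen's argument shows that X(x) and X(0) agree up to E_n(R[x])
    as soon as they do over the localizations of R at elements generating the unit ideal.
    This applies to unimodular columns with a monic entry (Horrocks) and to SL_2 blocks with
    a monic entry (Mennicke symbols), and Nagata's change of variables produces the monic
    entry.  Maximal ideals are avoided: each argument only localizes at explicit elements. *)

Require Import Defs.
From HB Require Import structures.
From mathcomp Require Import all_boot all_order all_algebra.
From mathcomp Require Import complex Rstruct reals.
From mathcomp Require Import mpoly ring lra zify.

Set Implicit Arguments.
Unset Strict Implicit.
Unset Printing Implicit Defensive.

Import Order.TTheory GRing.Theory Num.Theory.
Local Open Scope ring_scope.

(** * Elementary matrices *)

(** The root subgroups used for the spectral gap are finite, so the projections onto their invariant
    vectors are finite averages and every estimate is a computation with sums. The variables sit on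
    the closing edge of the cycle only: each adjacent pair then contains a copy of F_p acting on the
    coefficients of the other root group by scaling, so commutators with a fixed nonzero scalar run
    through the whole centre. This is what produces the cosine p^(-1/2). The factor 2 in 1 - 2c
    counts the two neighbours of an index.

    The equality SL_n = E_n is used twice: for finite generation, and to pass from invariance under
    the generators to invariance under the group.

    In the patching part the rings are domains. Localizations are therefore predicates on one
    fraction field, and matrices over different localizations live in the same type and can be
    multiplied. Denominators appear when an elementary matrix is conjugated by one defined over a
    localization; the proof of normality of E_n, kept with explicit denominators, absorbs them, and
    this is where n >= 3 is essential. *)

Definition subring (B : comNzRingType) (T : B -> Prop) : Prop :=
  [/\ T 1, forall x y, T x -> T y -> T (x - y) & forall x y, T x -> T y -> T (x * y)].

Section Subring.
Variables (B : comNzRingType) (T : B -> Prop).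
Hypothesis sT : subring T.

Lemma subring1 : T 1. Proof. by case: sT. Qed.
Lemma subringB x y : T x -> T y -> T (x - y). Proof. by case: sT => _ + _; apply. Qed.
Lemma subringM x y : T x -> T y -> T (x * y). Proof. by case: sT => _ _; apply. Qed.
Lemma subring0 : T 0. Proof. by rewrite -(subrr 1); apply: subringB; apply: subring1. Qed.
Lemma subringN x : T x -> T (- x). Proof. by rewrite -sub0r; apply: subringB; apply: subring0. Qed.
Lemma subringD x y : T x -> T y -> T (x + y).
Proof. by move=> Tx Ty; rewrite -(opprK y); apply: subringB => //; apply: subringN. Qed.
Lemma subringX x n : T x -> T (x ^+ n).
Proof. by move=> Tx; elim: n => [|n IHn]; rewrite ?expr0 ?exprS; [apply: subring1|apply: subringM]. Qed.
Lemma subring_sum (I : Type) (r : seq I) (P : pred I) (F : I -> B) :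
  (forall i, P i -> T (F i)) -> T (\sum_(i <- r | P i) F i).
Proof. by move=> TF; apply: big_ind => //; [apply: subring0|apply: subringD]. Qed.

End Subring.

Section Elementary.
Variables (B : comNzRingType) (n : nat).
Implicit Types (T : B -> Prop) (M : 'M[B]_n).

Definition elem (i j : 'I_n) (a : B) : 'M[B]_n := 1%:M + a *: delta_mx i j.

(* The group E_n over a subring [T] of [B]; that inverses need not be added is [El_inv]. *)
Inductive El T : 'M[B]_n -> Prop :=
| El1 : El T 1%:M
| ElR i j a M : El T M -> i != j -> T a -> El T (M *m elem i j a).

Lemma El_elem T i j a : i != j -> T a -> El T (elem i j a).
Proof. by move=> ij Ta; rewrite -[elem _ _ _]mul1mx; apply: ElR => //; apply: El1. Qed.

Lemma El_mul T M N : El T M -> El T N -> El T (M *m N).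
Proof.
move=> EM; elim=> [|i j a N' _ IH ij Ta]; first by rewrite mulmx1.
by rewrite mulmxA; apply: ElR.
Qed.

Lemma elemD i j a b : i != j -> elem i j a *m elem i j b = elem i j (a + b).
Proof.
move=> ij; rewrite /elem mulmxDl mul1mx mulmxDr mulmx1 -scalemxAl -scalemxAr.
by rewrite mul_delta_mx_cond eq_sym (negPf ij) mulr0n !scaler0 addr0 scalerDl -addrA [_ *: _ + _]addrC.
Qed.

Lemma elem0 i j : elem i j 0 = 1%:M.
Proof. by rewrite /elem scale0r addr0. Qed.

Lemma elem_entry T i j a k l : subring T -> T a -> T (elem i j a k l).
Proof.
move=> sT Ta; rewrite !mxE; apply: (subringD sT).
  by case: eqP => _; [apply: (subring1 sT)|apply: (subring0 sT)].
apply: (subringM sT) => //; case: andP => _; [exact: (subring1 sT)|exact: (subring0 sT)].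
Qed.

Lemma El_entry T M : subring T -> El T M -> forall i j, T (M i j).
Proof.
move=> sT; elim=> [|i j a N _ IH ij Ta] k l.
  by rewrite mxE; case: eqP => _; [apply: (subring1 sT)|apply: (subring0 sT)].
by rewrite mxE; apply: (subring_sum sT) => m _; apply: (subringM sT) => //; apply: elem_entry.
Qed.

Lemma El_inv T M : subring T -> El T M ->
  exists M', [/\ El T M', M *m M' = 1%:M & M' *m M = 1%:M].
Proof.
move=> sT; elim=> [|i j a N _ [N' [EN' NN' N'N]] ij Ta].
  by exists 1%:M; rewrite mul1mx; split=> //; apply: El1.
exists (elem i j (- a) *m N'); split.
- by apply: El_mul => //; apply: El_elem => //; apply: (subringN sT).
- by rewrite -mulmxA (mulmxA (elem _ _ a)) elemD // subrr elem0 mul1mx.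
by rewrite -mulmxA (mulmxA N') N'N mul1mx elemD // addNr elem0.
Qed.

Lemma trmx_elem i j a : (elem i j a)^T = elem j i a.
Proof. by rewrite /elem linearD /= linearZ /= trmx1 trmx_delta. Qed.

Lemma El_tr T M : El T M -> El T M^T.
Proof.
elim=> [|i j a N _ IH ij Ta]; first by rewrite trmx1; apply: El1.
rewrite trmx_mul trmx_elem; apply: El_mul => //.
by apply: El_elem => //; rewrite eq_sym.
Qed.

Lemma det_elem i j a : i != j -> \det (elem i j a) = 1.
Proof.
wlog ij : i j / (i < j)%N => [hw|nij].
  move=> ij; have: (i < j)%N || (j < i)%N by rewrite -neq_ltn.
  case/orP=> h; first exact: hw.
  by rewrite -det_tr trmx_elem; apply: hw => //; rewrite eq_sym.
rewrite -det_tr trmx_elem det_trig.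
  apply: big1 => k _; rewrite !mxE eqxx; case: eqP => [->|]; last by rewrite mulr0 addr0.
  by rewrite eq_sym (negPf nij) mulr0 addr0.
apply/is_trig_mxP => k l kl; rewrite !mxE -val_eqE /= (ltn_eqF kl) add0r.
case: eqP => [ek|]; last by rewrite mulr0.
case: eqP => [el|]; last by rewrite mulr0.
by move: kl; rewrite ek el ltnNge ltnW.
Qed.

Lemma El_det T M : El T M -> \det M = 1.
Proof.
by elim=> [|i j a N _ IH ij Ta]; rewrite ?det1 // det_mulmx IH det_elem ?mulr1.
Qed.

End Elementary.
Arguments El {B n} T M.
Arguments elem {B n} i j a.

Section ElMap.
Variables (B B' : comNzRingType) (f : {rmorphism B -> B'}) (n : nat).

Lemma map_elem i j a : map_mx f (elem i j a : 'M_n) = elem i j (f a).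
Proof. by rewrite /elem map_mxD map_mx1 map_mxZ map_delta_mx. Qed.

Lemma El_map (T : B -> Prop) (T' : B' -> Prop) (M : 'M_n) :
  (forall x, T x -> T' (f x)) -> El T M -> El T' (map_mx f M).
Proof.
move=> TT'; elim=> [|i j a N _ IH ij Ta]; first by rewrite map_mx1; apply: El1.
by rewrite map_mxM map_elem; apply: ElR => //; apply: TT'.
Qed.

Lemma El_lift (T : B -> Prop) (T' : B' -> Prop) (M : 'M_n) :
  (forall y, T' y -> exists2 x, T x & f x = y) -> El T' M ->
  exists2 N, El T N & map_mx f N = M.
Proof.
move=> TT'; elim=> [|i j a N _ [N' EN' <-] ij Ta].
  by exists 1%:M; [apply: El1|rewrite map_mx1].
have [x Tx <-] := TT' _ Ta.
by exists (N' *m elem i j x); [apply: ElR|rewrite map_mxM map_elem].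
Qed.

End ElMap.

Lemma ord_avoid2 n (k l : 'I_n) : (3 <= n)%N -> exists2 m : 'I_n, m != k & m != l.
Proof.
move=> n3; have: (0 < #|~: [set k; l]|)%N.
  rewrite -(ltn_add2l #|[set k; l]|) cardsC addn0 card_ord cards2.
  by apply: leq_trans n3; case: (_ != _).
by case/card_gt0P => m; rewrite !inE negb_or => /andP[]; exists m.
Qed.

(** * Normality of the elementary group in rank at least 3 *)

Section Suslin.
Variables (B : comNzRingType) (n : nat) (T : B -> Prop).
Hypothesis sT : subring T.

(** The matrix is the product of the [elem i m (p i 0)] for [i != m]. The partial sums [X] keep row
    [m] equal to zero, which kills the cross terms. *)
Lemma El_addcol (p : 'cV[B]_n) (m : 'I_n) :
  (forall i, T (p i 0)) -> p m 0 = 0 -> El T (1%:M + p *m delta_mx 0 m).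
Proof.
move=> Tp pm.
have -> : p *m delta_mx 0 m = \sum_(i | i != m) p i 0 *: delta_mx i m.
  rewrite {1}[p]matrix_sum_delta mulmx_suml (bigD1 m) //= big_ord1 pm scale0r mul0mx add0r.
  by apply: eq_bigr => i _; rewrite big_ord1 -scalemxAl mul_delta_mx.
pose K X := row m X = 0 /\ El T (1%:M + X).
suff: K (\sum_(i | i != m) p i 0 *: delta_mx i m) by case.
apply: (big_rec K) => [|i X im [rX EX]].
  by split; [exact: row0|rewrite addr0; apply: El1].
have E : elem i m (p i 0) *m (1%:M + X) = 1%:M + (p i 0 *: delta_mx i m + X).
  rewrite /elem mulmxDl mul1mx mulmxDr mulmx1 -scalemxAl.
  rewrite -(mul_delta_mx (0 : 'I_1)) -mulmxA -rowE rX mulmx0 scaler0 addr0.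
  by rewrite addrAC -addrA.
split; last by rewrite -E; apply: El_mul => //; apply: El_elem.
rewrite linearD /= linearZ /= rX addr0; apply/rowP => k; rewrite !mxE.
by rewrite eq_sym (negPf im) mulr0.
Qed.

Lemma El_addrow (q : 'rV[B]_n) (m : 'I_n) :
  (forall i, T (q 0 i)) -> q 0 m = 0 -> El T (1%:M + delta_mx m 0 *m q).
Proof.
move=> Tq qm; rewrite -[X in El T X]trmxK; apply: El_tr.
rewrite linearD /= trmx1 trmx_mul trmx_delta; apply: El_addcol => [i|]; by rewrite mxE.
Qed.

(* The commutator of [1 + p e_m] and [1 + e_m q], where [q p = q_m = p_m = 0]. *)
Lemma El_rank1_off (p : 'cV[B]_n) (q : 'rV[B]_n) (m : 'I_n) :
  (forall i, T (p i 0)) -> (forall i, T (q 0 i)) -> p m 0 = 0 -> q 0 m = 0 ->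
  q *m p = 0 -> El T (1%:M + p *m q).
Proof.
move=> Tp Tq pm qm qp.
pose em : 'rV[B]_n := delta_mx 0 m; pose fm : 'cV[B]_n := delta_mx m 0.
have ep : em *m p = 0.
  by rewrite -rowE; apply/matrixP => i j; rewrite !mxE ord1 pm.
have qf : q *m fm = 0.
  by rewrite -colE; apply/matrixP => i j; rewrite !mxE ord1 qm.
have ef : em *m fm = 1%:M.
  by rewrite mul_delta_mx; apply/matrixP => i j; rewrite !mxE !ord1.
have -> : 1%:M + p *m q =
  (1%:M + p *m em) *m (1%:M + fm *m q) *m (1%:M + (- p) *m em) *m (1%:M + fm *m (- q)).
  pose U := p *m em; pose V := fm *m q.
  have UU : U *m U = 0 by rewrite mulmxA -(mulmxA p) ep mulmx0 mul0mx.
  have VV : V *m V = 0 by rewrite mulmxA -(mulmxA fm) qf mulmx0 mul0mx.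
  have VU : V *m U = 0 by rewrite mulmxA -(mulmxA fm) qp mulmx0 mul0mx.
  have UV : U *m V = p *m q by rewrite mulmxA -(mulmxA p) ef mulmx1.
  rewrite mulNmx mulmxN -/U -/V -UV.
  move: U V UU VV VU {UV} => U V UU VV VU.
  have -> : (1%:M + U) *m (1%:M + V) *m (1%:M - U) = 1%:M + V + U *m V.
    rewrite mulmxBr mulmx1 mulmxDr mulmx1 !mulmxDl !mul1mx -mulmxA VU UU mulmx0.
    by rewrite !addr0 -(addrA 1%:M) [U + _]addrC addrA addrK addrA.
  rewrite mulmxBr mulmx1 !mulmxDl !mul1mx -mulmxA VV mulmx0.
  by rewrite !addr0 addrAC addrK.
apply: El_mul; last first.
  by apply: El_addrow => [i|]; rewrite mxE ?qm ?oppr0 //; apply: (subringN sT).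
apply: El_mul; last first.
  by apply: El_addcol => [i|]; rewrite mxE ?pm ?oppr0 //; apply: (subringN sT).
by apply: El_mul; [apply: El_addcol|apply: El_addrow].
Qed.

(** The entry [w 0 m] is split off: since [p m 0 = 0], the row [w 0 m *: delta_mx 0 m] also kills
    [p]. So the remainder [q] satisfies [El_rank1_off], and the two rank-one factors multiply
    without cross term. *)
Lemma El_rank1_zero (p : 'cV[B]_n) (w : 'rV[B]_n) (m : 'I_n) :
  (forall i, T (p i 0)) -> (forall i, T (w 0 i)) -> p m 0 = 0 ->
  w *m p = 0 -> El T (1%:M + p *m w).
Proof.
move=> Tp Tw pm wp; pose wm := w 0 m *: (delta_mx 0 m : 'rV[B]_n); pose q := w - wm.
have mp : wm *m p = 0.
  rewrite -scalemxAl -rowE; apply/matrixP => i j; rewrite !mxE ord1 pm mulr0 //.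
have qp : q *m p = 0 by rewrite mulmxBl wp mp subrr.
have -> : 1%:M + p *m w = (1%:M + p *m q) *m (1%:M + (w 0 m *: p) *m delta_mx 0 m).
  rewrite -scalemxAl scalemxAr -/wm mulmxDl mul1mx mulmxDr mulmx1 -mulmxA (mulmxA q) qp mul0mx mulmx0.
  by rewrite addr0 -addrA -mulmxDr [wm + _]addrC subrK.
apply: El_mul; last first.
  by apply: El_addcol => [i|]; rewrite mxE ?pm ?mulr0 //; apply: (subringM sT).
apply: (@El_rank1_off _ _ m) => // [i|]; rewrite !mxE.
  apply: (subringB sT) => //; apply: (subringM sT) => //.
  by case: andP => _; [exact: (subring1 sT)|exact: (subring0 sT)].
by rewrite !eqxx mulr1 subrr.
Qed.

(* As [w p = 0] and [w z = kappa], the column [kappa p] is the sum over [k < l] of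
   [(p_k z_l - z_k p_l) (w_l e_k - w_k e_l)], each term being orthogonal to [w]. *)
Lemma El_rank1 (p z : 'cV[B]_n) (w : 'rV[B]_n) (kappa : B) :
  (3 <= n)%N ->
  (forall i, T (p i 0)) -> (forall i, T (z i 0)) -> (forall i, T (w 0 i)) ->
  w *m p = 0 -> w *m z = kappa%:M -> El T (1%:M + (kappa *: p) *m w).
Proof.
move=> n3 Tp Tz Tw wp wz.
pose a k l := p k 0 * z l 0 - z k 0 * p l 0.
pose e (k l : 'I_n) : 'cV[B]_n := w 0 l *: delta_mx k 0 - w 0 k *: delta_mx l 0.
have wdelta (k : 'I_n) : w *m delta_mx k 0 = (w 0 k)%:M :> 'M_1.
  by rewrite -colE; apply/matrixP => i j; rewrite !mxE !ord1 mulr1n.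
have Ta k l : T (a k l) by apply: (subringB sT); apply: (subringM sT).
have -> : kappa *: p = \sum_(k < n) \sum_(l < n | (k < l)%N) a k l *: e k l.
  have sumT (F : 'I_n -> 'I_n -> 'cV[B]_n) : (forall k, F k k = 0) ->
     \sum_(k < n) \sum_(l < n) F k l = \sum_(k < n) \sum_(l < n | (k < l)%N) (F k l + F l k).
    move=> F0; have -> : \sum_(k < n) \sum_(l < n | (k < l)%N) (F k l + F l k) =
        \sum_(k < n) \sum_(l < n | (k < l)%N) F k l + \sum_(k < n) \sum_(l < n | (k < l)%N) F l k.
      by rewrite -big_split; apply: eq_bigr => k _; rewrite big_split.
    rewrite [X in _ = _ + X](exchange_big_dep predT) //= -big_split /=.
    apply: eq_bigr => k _; rewrite (bigD1 k) //= F0 add0r.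
    rewrite (bigID (fun l : 'I_n => (k < l)%N)) /=; congr (_ + _); apply: eq_bigl => l.
      by rewrite -val_eqE /= neq_ltn andb_orl; case: ltngtP.
    by rewrite -val_eqE /= neq_ltn -leqNgt; case: ltngtP.
  transitivity (\sum_(k < n) \sum_(l < n) (a k l * w 0 l) *: (delta_mx k 0 : 'cV[B]_n)).
    apply/matrixP => i j; rewrite !ord1 summxE (bigD1 i) //= [X in _ + X]big1 => [|k ki].
      rewrite addr0 summxE mxE.
      have: (w *m z) 0 0 = kappa by rewrite wz mxE eqxx mulr1n.
      rewrite !mxE => <-; have: (w *m p) 0 0 = 0 by rewrite wp mxE.
      rewrite mxE => wp0; rewrite mulrC mulr_sumr.
      transitivity (\sum_l (p i 0 * (w 0 l * z l 0) - z i 0 * (w 0 l * p l 0))).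
        by rewrite sumrB -[X in _ - X]mulr_sumr wp0 mulr0 subr0.
      apply: eq_bigr => l _; rewrite !mxE !eqxx /a /=. ring.
    rewrite summxE big1 // => l _.
    by rewrite !mxE eq_sym (negPf ki) mulr0.
  rewrite sumT => [|k]; last by rewrite /a [z _ _ * _]mulrC subrr mul0r scale0r.
  apply: eq_bigr => k _; apply: eq_bigr => l _; rewrite /e scalerBr !scalerA.
  congr (_ + _); rewrite -scaleNr; congr (_ *: _); rewrite /a; ring.
pose K (x : 'cV[B]_n) := w *m x = 0 /\ El T (1%:M + x *m w).
have K0 : K 0 by split; [exact: mulmx0|rewrite mul0mx addr0; apply: El1].
have KD x y : K x -> K y -> K (x + y).
  move=> [wx Ex] [wy Ey]; split; first by rewrite mulmxDr wx wy addr0.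
  suff -> : 1%:M + (x + y) *m w = (1%:M + x *m w) *m (1%:M + y *m w) by apply: El_mul.
  rewrite mulmxDl mul1mx mulmxDr mulmx1 -mulmxA (mulmxA w) wy mul0mx mulmx0 addr0.
  by rewrite mulmxDl addrA addrAC.
suff: K (\sum_(k < n) \sum_(l < n | (k < l)%N) a k l *: e k l) by case.
apply: (big_ind K) => // k _; apply: (big_ind K) => // l kl.
have we : w *m (a k l *: e k l) = 0.
  by rewrite -scalemxAr mulmxBr -!scalemxAr !wdelta !scale_scalar_mx mulrC subrr scaler0.
(* A third index exists because [3 <= n]; [e k l] vanishes there, as [El_rank1_zero] requires. *)
split=> //; have [m mk ml] : exists2 m : 'I_n, m != k & m != l.
  exact: ord_avoid2.
apply: (@El_rank1_zero _ _ m) => // [i|]; rewrite !mxE.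
  apply: (subringM sT) => //; apply: (subringB sT); apply: (subringM sT) => //;
  by case: andP => _; [exact: (subring1 sT)|exact: (subring0 sT)].
by rewrite (negPf mk) (negPf ml) !mulr0 subr0 mulr0.
Qed.

(** The conjugate is 1 plus a multiple of column [i] of [U] times row [j] of [U']. Of the four
    factors [e], two clear the denominators of this column and row; the other two form
    [kappa = w z], where [z] is column [j] of [U], scaled by [e]. *)
Lemma El_conj_denom (U U' : 'M[B]_n) (e h : B) (i j : 'I_n) :
  (3 <= n)%N -> U' *m U = 1%:M -> (forall k l, T (e * U k l)) ->
  (forall k l, T (e * U' k l)) -> T h -> i != j ->
  U *m U' = 1%:M -> El T (U *m elem i j (e ^+ 4 * h) *m U').
Proof.
move=> n3 U'U TU TU' Th ij UU'.
pose p := (h * e) *: col i U; pose w := e *: row j U'; pose z := e *: col j U.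
have -> : U *m elem i j (e ^+ 4 * h) *m U' = 1%:M + (e ^+ 2 *: p) *m w.
  rewrite /elem mulmxDr mulmx1 mulmxDl UU' -scalemxAr -!scalemxAl; congr (_ + _).
  rewrite -(mul_delta_mx (0 : 'I_1)) mulmxA -colE -mulmxA -rowE /p /w.
  by rewrite -!scalemxAr !scalerA; congr (_ *: _); ring.
have rc k l : row k U' *m col l U = (k == l)%:R%:M :> 'M_1.
  rewrite rowE colE mulmxA -(mulmxA _ U') U'U mulmx1 -rowE.
  by apply/matrixP => a b; rewrite !mxE !ord1 eqxx !andbT mulr1n eq_sym.
apply: (@El_rank1 p z w) => // [k|k|k||]; rewrite ?mxE.
- by rewrite -mulrA; apply: (subringM sT).
- exact: TU.
- exact: TU'.
- by rewrite -scalemxAl -scalemxAr rc eq_sym (negPf ij) scale_scalar_mx mulr0 scale_scalar_mx mulr0 -scalemx1 scale0r.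
by rewrite -scalemxAl -scalemxAr rc eqxx !scale_scalar_mx mulr1.
Qed.

(** Suslin's normality theorem, the case [e = 1] of the preceding lemma. *)
Lemma El_conj (U U' M : 'M[B]_n) :
  (3 <= n)%N -> (forall k l, T (U k l)) -> (forall k l, T (U' k l)) ->
  U *m U' = 1%:M -> U' *m U = 1%:M -> El T M -> El T (U *m M *m U').
Proof.
move=> n3 TU TU' UU' U'U; elim=> [|i j a N _ IH ij Ta].
  by rewrite mulmx1 UU'; apply: El1.
have -> : U *m (N *m elem i j a) *m U' = (U *m N *m U') *m (U *m elem i j a *m U').
  by rewrite !mulmxA -[_ *m U' *m U]mulmxA U'U mulmx1.
apply: El_mul => //; rewrite -[a]mul1r -(expr1n _ 4).
by apply: El_conj_denom => // k l; rewrite mul1r.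
Qed.

End Suslin.

(** * Quillen patching *)

Section PolyIn.
Variable L : fieldType.
Implicit Types (S : L -> Prop) (p q a b r : {poly L}) (c : L).

(* Localizations of the base ring are represented as subsets of a fixed field [L];
   for [c = 0] the set [loc S c] is all of [L] and carries no information. *)
Definition polyin S p := forall k, S p`_k.
Definition loc S c (x : L) := exists N, S (c ^+ N * x).

Lemma subring_polyin S : subring S -> subring (polyin S).
Proof.
move=> sS; split=> [k|p q Sp Sq k|p q Sp Sq k].
- by rewrite coef1; case: eqP => _; [exact: subring1|exact: subring0].
- by rewrite coefB; apply: (subringB sS).
by rewrite coefM; apply: (subring_sum sS) => i _; apply: (subringM sS).
Qed.

Lemma polyinC S c : subring S -> S c -> polyin S c%:P.
Proof. by move=> sS Sc k; rewrite coefC; case: eqP => // _; apply: subring0. Qed.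

Lemma polyinX S : subring S -> polyin S 'X.
Proof. by move=> sS k; rewrite coefX; case: eqP => _; [exact: subring1|exact: subring0]. Qed.

Lemma polyinZ S c p : subring S -> S c -> polyin S p -> polyin S (c *: p).
Proof. by move=> sS Sc Sp k; rewrite coefZ; apply: (subringM sS). Qed.

Lemma polyin_cons S p c :
  polyin S (p * 'X + c%:P) -> polyin S p /\ S c.
Proof.
move=> H; split=> [k|].
  by have := H k.+1; rewrite coefD coefMX coefC /= addr0.
by have := H 0; rewrite coefD coefMX coefC /= add0r.
Qed.

Lemma polyin_comp S p q : subring S -> polyin S p -> polyin S q -> polyin S (p \Po q).
Proof.
move=> sS + Sq; have sP := subring_polyin sS; elim/poly_ind: p => [|p c IH].
  by move=> _; rewrite comp_poly0; apply: (subring0 sP).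
case/polyin_cons => /IH Sp Sc; rewrite comp_poly_MXaddC.
by apply: (subringD sP); [apply: (subringM sP)|apply: polyinC].
Qed.

Lemma comp_poly_diff S p a t : subring S -> polyin S p -> polyin S a -> polyin S t ->
  exists2 h, polyin S h & p \Po (a + t) - (p \Po a) = t * h.
Proof.
move=> sS + Sa St; have sP := subring_polyin sS; elim/poly_ind: p => [|p c IH].
  by move=> _; exists 0; [apply: (subring0 sP)|rewrite !comp_poly0 mulr0 subrr].
case/polyin_cons => Sp Sc; have [h Sh e] := IH Sp.
exists (h * (a + t) + (p \Po a)).
  by apply: (subringD sP); [apply: (subringM sP) => //; apply: (subringD sP)|apply: polyin_comp].
rewrite !comp_poly_MXaddC [RHS]mulrDr [t * (h * _)]mulrA -e; ring.
Qed.

Lemma subring_loc S c : subring S -> S c -> subring (loc S c).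
Proof.
move=> sS Sc; split=> [|x y [N Sx] [M Sy]|x y [N Sx] [M Sy]].
- by exists 0; rewrite mulr1; apply: (subring1 sS).
- exists (N + M)%N.
  have -> : c ^+ (N + M) * (x - y) = c ^+ M * (c ^+ N * x) - c ^+ N * (c ^+ M * y).
    by rewrite exprD; ring.
  by apply: (subringB sS); apply: (subringM sS) => //; apply: (subringX sS).
exists (N + M)%N.
have -> : c ^+ (N + M) * (x * y) = (c ^+ N * x) * (c ^+ M * y) by rewrite exprD; ring.
exact: (subringM sS).
Qed.

Lemma sub_loc S c x : S x -> loc S c x.
Proof. by move=> Sx; exists 0; rewrite mul1r. Qed.

Lemma loc_inv S c : subring S -> c != 0 -> loc S c c^-1.
Proof. by move=> sS c0; exists 1%N; rewrite expr1 divff //; apply: (subring1 sS). Qed.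

Lemma polyin_loc S c p : polyin S p -> polyin (loc S c) p.
Proof. by move=> Sp k; apply: sub_loc. Qed.

Lemma eventually_fin (I : finType) (P : I -> nat -> Prop) :
  (forall i, exists N, forall m, (N <= m)%N -> P i m) ->
  exists N, forall m, (N <= m)%N -> forall i, P i m.
Proof.
move=> H; suff [N HN] : exists N, forall m, (N <= m)%N -> forall i, i \in enum I -> P i m.
  by exists N => m Nm i; apply: HN => //; rewrite mem_enum.
elim: (enum I) => [|j s [N IH]]; first by exists 0.
have [M HM] := H j; exists (maxn N M) => m; rewrite geq_max => /andP[Nm Mm] i.
by rewrite inE => /predU1P[->|]; [apply: HM|apply: IH].
Qed.

Lemma polyin_denom S c p : subring S -> S c -> polyin (loc S c) p ->
  exists N, forall m, (N <= m)%N -> polyin S (c ^+ m *: p).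
Proof.
move=> sS Sc Sp.
have [|N HN] := @eventually_fin 'I_(size p) (fun i m => S (c ^+ m * p`_i)).
  move=> i; have [N SN] := Sp i; exists N => m Nm.
  by rewrite -(subnK Nm) exprD -mulrA; apply: (subringM sS) => //; apply: (subringX sS).
exists N => m Nm k; rewrite coefZ.
have [kp|pk] := ltnP k (size p); first exact: (HN m Nm (Ordinal kp)).
by rewrite nth_default // mulr0; apply: (subring0 sS).
Qed.

Lemma matrix_polyin_denom S c n m (M : 'M[{poly L}]_(n, m)) : subring S -> S c ->
  (forall i j, polyin (loc S c) (M i j)) ->
  exists N, forall k, (N <= k)%N -> forall i j, polyin S (c ^+ k *: M i j).
Proof.
move=> sS Sc SM.
apply: (@eventually_fin _ (fun i k => forall j, polyin S (c ^+ k *: M i j))) => i.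
apply: (@eventually_fin _ (fun j k => polyin S (c ^+ k *: M i j))) => j.
exact: polyin_denom.
Qed.

Definition mx_subst n m a (X : 'M[{poly L}]_(n, m)) := map_mx (comp_poly a) X.

Lemma mx_substM n m k a (X : 'M[{poly L}]_(n, m)) (Y : 'M_(m, k)) :
  mx_subst a (X *m Y) = mx_subst a X *m mx_subst a Y.
Proof. exact: map_mxM. Qed.

Lemma mx_subst1 n a : mx_subst a (1%:M : 'M_n) = 1%:M.
Proof. exact: map_mx1. Qed.

Lemma mx_subst_elem n a i j p : mx_subst a (elem i j p : 'M_n) = elem i j (p \Po a).
Proof. exact: map_elem. Qed.

Lemma mx_substX n m (X : 'M[{poly L}]_(n, m)) : mx_subst 'X X = X.
Proof. by apply/matrixP => i j; rewrite mxE comp_polyXr. Qed.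

Lemma mx_subst_comp n m a b (X : 'M[{poly L}]_(n, m)) : mx_subst a (mx_subst b X) = mx_subst (b \Po a) X.
Proof. by apply/matrixP => i j; rewrite !mxE comp_polyA. Qed.

Lemma El_subst S n a (E : 'M[{poly L}]_n) : subring S -> polyin S a ->
  El (polyin S) E -> El (polyin S) (mx_subst a E).
Proof. by move=> sS Sa; apply: El_map => p Sp; apply: polyin_comp. Qed.

(* [E(b) E(a)^-1] is a product of conjugates of elementary matrices with entries divisible by a
   high power of [c]; by [El_conj_denom] these have entries in [S[x]]. *)
Lemma El_dilation S c n (E : 'M[{poly L}]_n) :
  subring S -> S c -> c != 0 -> (3 <= n)%N -> El (polyin (loc S c)) E ->
  exists N, forall m, (N <= m)%N -> forall a r, polyin S a -> polyin S r ->
  exists2 E', El (polyin S) E' & mx_subst (a + c ^+ m *: r) E = E' *m mx_subst a E.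
Proof.
move=> sS Sc c0 n3; have sP := subring_polyin sS.
have sPl := subring_polyin (subring_loc sS Sc).
elim=> [|i j f M EM [N0 IH] ij Sf].
  by exists 0 => m _ a r _ _; exists 1%:M; [exact: El1|rewrite !mx_subst1 mul1mx].
have [M' [EM' MM' M'M]] := El_inv sPl EM.
have [N1 H1] := matrix_polyin_denom sS Sc (El_entry sPl EM).
have [N1' H1'] := matrix_polyin_denom sS Sc (El_entry sPl EM').
have [N2 H2] := polyin_denom sS Sc Sf.
pose d := maxn N1 N1'.
(* [N0] serves the factor [M], [N2] clears the denominators of [f], and [c ^+ d] those of [M] and
   its inverse; the last is needed four times by [El_conj_denom]. *)
exists (maxn N0 (4 * d + N2)) => m; rewrite geq_max => /andP[mN0 mN2] a r Sa Sr.
have [E0 EE0 e0] := IH m mN0 a r Sa Sr.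
set b := a + c ^+ m *: r in e0 *.
have Sr' k : polyin S (c ^+ k *: r) by apply: polyinZ => //; apply: (subringX sS).
have [h0 Sh0 eh0] := comp_poly_diff sS (H2 _ (leqnn _)) Sa (Sr' m).
pose e := (c ^+ d)%:P; pose h := c ^+ (m - (4 * d + N2)) *: (r * h0).
have eh : (f \Po b) - (f \Po a) = e ^+ 4 * h.
  have cN2 : c ^+ N2 != 0 by rewrite expf_neq0.
  apply: (scalerI cN2); rewrite scalerBr -!comp_polyZ eh0 /h /e.
  rewrite -polyC_exp mul_polyC !scalerA -exprM -!exprD scalerAl; congr (_ ^+ _ *: _ * _).
  by rewrite [(N2 + _)%N]addnC mulnC subnKC.
have Sh : polyin S h by apply: polyinZ; [|apply: (subringX sS)|apply: (subringM sP)].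
exists (E0 *m (mx_subst a M *m elem i j (e ^+ 4 * h) *m mx_subst a M')); last first.
  rewrite !mx_substM !mx_subst_elem e0 -eh -!mulmxA; congr (_ *m (_ *m _)).
  by rewrite (mulmxA (mx_subst a M')) -mx_substM M'M mx_subst1 mul1mx elemD // subrK.
apply: El_mul => //; apply: El_conj_denom => //; rewrite -?mx_substM ?MM' ?M'M ?mx_subst1 //.
- move=> k l; rewrite mxE /e mul_polyC -comp_polyZ; apply: polyin_comp => //.
  by apply: H1; rewrite leq_maxl.
move=> k l; rewrite mxE /e mul_polyC -comp_polyZ; apply: polyin_comp => //.
by apply: H1'; rewrite leq_maxr.
Qed.

End PolyIn.

Section LocalGlobal.
Variables (L : fieldType) (n m : nat).
Implicit Types (S : L -> Prop) (a b r : {poly L}) (c : L) (X : 'M[{poly L}]_(n, m)).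
Hypothesis n3 : (3 <= n)%N.

Definition cong S X b a := exists2 E, El (polyin S) E & mx_subst b X = E *m mx_subst a X.
(** With [b = 'X] and [a = 0] this compares [X] with its value at 0. Allowing all substitutions lets
    comparisons be chained through intermediate points. *)
Definition constant_mod_El S X := forall a b, polyin S a -> polyin S b -> cong S X b a.

Lemma cong_refl S X a : cong S X a a.
Proof. by exists 1%:M; [exact: El1|rewrite mul1mx]. Qed.

Lemma cong_trans S X a b d : cong S X a b -> cong S X b d -> cong S X a d.
Proof.
move=> [E EE e] [F EF f]; exists (E *m F); first exact: El_mul.
by rewrite e f mulmxA.
Qed.

Lemma constant_mod_ElM S X E : subring S -> El (polyin S) E ->
  constant_mod_El S (E *m X) -> constant_mod_El S X.
Proof.
move=> sS EE H a b Sa Sb; have sP := subring_polyin sS.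
have [F EF e] := H a b Sa Sb; have [E' [EE' _ E'E]] := El_inv sP EE.
exists (mx_subst b E' *m F *m mx_subst a E).
  by apply: El_mul; [apply: El_mul => //|]; apply: El_subst.
by rewrite -!mulmxA -mx_substM -e -mx_substM mulmxA E'E mul1mx.
Qed.

(* Some power of [c] lies in the Quillen ideal of [X]; [b = a + c^N r] replaces the usual
   second variable. *)
Definition quillen_power S X c :=
  S c /\ exists N, forall a r, polyin S a -> polyin S r -> cong S X (a + c ^+ N *: r) a.

Lemma quillen0 S X : subring S -> quillen_power S X 0.
Proof.
move=> sS; split; first exact: subring0; exists 1%N => a r _ _.
by rewrite scale0r addr0; apply: cong_refl.
Qed.

Lemma quillenM S X s c : subring S -> S s -> quillen_power S X c -> quillen_power S X (s * c).
Proof.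
move=> sS Ss [Sc [N H]]; split; first exact: (subringM sS).
exists N => a r Sa Sr; rewrite exprMn mulrC -scalerA; apply: H => //.
by apply: polyinZ => //; apply: (subringX sS).
Qed.

Lemma exprD_split S c d N M : subring S -> S c -> S d ->
  exists s t, [/\ S s, S t & (c + d) ^+ (N + M) = s * c ^+ N + t * d ^+ M].
Proof.
move=> sS Sc Sd; rewrite exprDn.
pose K x := exists s t, [/\ S s, S t & x = s * c ^+ N + t * d ^+ M].
apply: (big_ind K).
- by exists 0, 0; rewrite !mul0r addr0; split=> //; apply: (subring0 sS).
- move=> _ _ [s [t [Ss St ->]]] [s' [t' [Ss' St' ->]]].
  by exists (s + s'), (t + t'); split; [apply: (subringD sS)..|ring].
move=> i _; have Sn x k : S x -> S (x *+ k).
  by move=> Sx; elim: k => [|k IH]; rewrite ?mulr0n ?mulrS; [apply: (subring0 sS)|apply: (subringD sS)].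
have [iM|Mi] := ltnP i M.
  have Ni : (N <= N + M - i)%N by rewrite -addnBA ?leq_addr // ltnW.
  exists ((c ^+ (N + M - i - N) * d ^+ i) *+ 'C(N + M, i)), 0; split; last 1 first.
  - by rewrite -[in LHS](subnK Ni) exprD mul0r addr0 mulrnAl mulrAC.
  - by apply: Sn; apply: (subringM sS); apply: (subringX sS).
  exact: (subring0 sS).
exists 0, ((c ^+ (N + M - i) * d ^+ (i - M)) *+ 'C(N + M, i)); split; last 1 first.
- have -> : d ^+ i = d ^+ (i - M) * d ^+ M by rewrite -exprD subnK.
  by rewrite mul0r add0r mulrnAl mulrA.
- exact: (subring0 sS).
by apply: Sn; apply: (subringM sS); apply: (subringX sS).
Qed.

(** One moves from [a] first by a multiple of [c ^+ N], then by a multiple of [d ^+ M]. Together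
    with [quillen0] and [quillenM] this makes the admissible [c] an ideal, so constancy follows once
    1 is shown to lie in it. *)
Lemma quillenD S X c d : subring S -> quillen_power S X c -> quillen_power S X d -> quillen_power S X (c + d).
Proof.
move=> sS [Sc [N Hc]] [Sd [M Hd]]; have sP := subring_polyin sS.
split; first exact: (subringD sS).
exists (N + M)%N => a r Sa Sr.
have [s [t [Ss St ->]]] := exprD_split N M sS Sc Sd.
have Sc' : polyin S (s *: r) by apply: polyinZ.
have Sd' : polyin S (t *: r) by apply: polyinZ.
have -> : a + (s * c ^+ N + t * d ^+ M) *: r = (a + c ^+ N *: (s *: r)) + d ^+ M *: (t *: r).
  by rewrite !scalerA -addrA -scalerDl; congr (_ + _ *: _); ring.
apply: cong_trans (Hc _ _ Sa Sc'); apply: Hd => //.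
by apply: (subringD sP) => //; apply: polyinZ => //; apply: (subringX sS).
Qed.

Lemma quillen1 S X : subring S -> quillen_power S X 1 -> constant_mod_El S X.
Proof.
move=> sS [_ [N H]] a b Sa Sb; rewrite -[b](addrNK a) addrC -[b - a]scale1r -(expr1n _ N).
by apply: H => //; apply: (subringB (subring_polyin sS)).
Qed.

(** Over the localization [X = E X(0)]. Dilation gives [E(a + c^N r) = E' E(a)] with [E'] over [S],
    and multiplying by [X(0)] gives [X(a + c^N r) = E' X(a)]. *)
Lemma quillen_loc S X c : subring S -> S c ->
  (c != 0 -> constant_mod_El (loc S c) X) -> quillen_power S X c.
Proof.
move=> sS Sc; have [->|c0] := eqVneq c 0; first by move=> _; apply: quillen0.
move=> /(_ isT) H; split=> //; have sl := subring_loc sS Sc.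
have [E EE] := H 0 'X (subring0 (subring_polyin sl)) (polyinX sl).
rewrite mx_substX => eX; have [N HN] := El_dilation sS Sc c0 n3 EE.
exists N => a r Sa Sr; have [E' EE' e] := HN N (leqnn _) a r Sa Sr.
exists E' => //; rewrite eX !mx_substM e !mx_subst_comp !comp_poly0 mulmxA //.
Qed.

End LocalGlobal.

(** * Unimodular columns *)

Section Horrocks.
Variable L : fieldType.
Implicit Types (S : L -> Prop) (f g h u : {poly L}) (c : L).

Lemma monic_of_coef f d : (size f <= d.+1)%N -> f`_d = 1 -> f \is monic /\ size f = d.+1.
Proof.
move=> sf fd; have sz : size f = d.+1.
  apply/eqP; rewrite eqn_leq sf ltnNge; apply/negP => /(nth_default 0); rewrite fd.
  by apply/eqP; rewrite oner_eq0.
by rewrite monicE lead_coefE sz fd.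
Qed.

Lemma coef_monic f d : f \is monic -> size f = d.+1 -> f`_d = 1.
Proof. by move=> /monicP <- sf; rewrite lead_coefE sf. Qed.

Lemma polyin_divmod S f g : subring S -> f \is monic -> polyin S f -> polyin S g ->
  exists2 q, polyin S q & (size (g - q * f)%R < size f)%N.
Proof.
move=> sS mf Sf; have sP := subring_polyin sS; have f0 := monic_neq0 mf.
have [n] := ubnP (size g); elim: n g => // n IH g; rewrite ltnS => gn Sg.
have [gf|fg] := ltnP (size g) (size f).
  by exists 0; [apply: (subring0 sP)|rewrite mul0r subr0].
have g0 : g != 0 by rewrite -size_poly_gt0 (leq_trans _ fg) // size_poly_gt0.
pose t := lead_coef g *: 'X^(size g - size f); pose g' := g - t * f.
have St : polyin S t.
  by apply: polyinZ => //; [exact: Sg|apply: (subringX sP); exact: polyinX].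
have sg' : (size g' < size g)%N.
  have st : size (t * f) = size g.
    rewrite -scalerAl size_scale ?lead_coef_eq0 // mulrC size_mulXn //.
    by rewrite subnK.
  have lt : lead_coef (t * f) = lead_coef g.
    by rewrite -scalerAl lead_coefZ lead_coefM lead_coefXn mul1r (monicP mf) mulr1.
  have gp : (0 < size g)%N by rewrite size_poly_gt0.
  rewrite -(prednK gp) ltnS; apply/leq_sizeP => j; rewrite leq_eqVlt => /predU1P[<-|jg].
    by rewrite coefB -lead_coefE -st -lead_coefE lt subrr.
  by rewrite prednK // in jg; rewrite coefB !nth_default ?subrr // st.
have [q Sq sq] := IH g' (leq_trans sg' gn) (subringB sP Sg (subringM sP St Sf)).
exists (t + q); first exact: (subringD sP).
by rewrite mulrDl opprD addrA.
Qed.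

(* The coefficients of degree [d] of the elements of [(f, g)] of degree at most [d]
   form an ideal, closed under [h |-> X h - h_d f]. *)
Lemma monic_in_ideal S f g d k c : subring S -> f \is monic -> size f = d.+2 ->
  polyin S f -> polyin S g -> (size g <= d.+1)%N -> (k <= d)%N -> S c -> c * g`_k = 1 ->
  exists a b, [/\ polyin S a, polyin S b, (size (a * f + b * g)%R <= d.+1)%N &
     (a * f + b * g)`_d = 1].
Proof.
move=> sS mf sf Sf Sg sg kd Sc ck; have sP := subring_polyin sS.
pose I h := exists a b, [/\ polyin S a, polyin S b, h = a * f + b * g & (size h <= d.+1)%N].
pose A t := exists2 h, I h & h`_d = t.
have SI h : I h -> polyin S h.
  by move=> [a [b [Sa Sb -> _]]]; apply: (subringD sP); apply: (subringM sP).
have AD s t : A s -> A t -> A (s + t).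
  move=> [h [a [b [Sa Sb eh sh]]] <-] [h' [a' [b' [Sa' Sb' eh' sh']]] <-].
  exists (h + h'); last by rewrite coefD.
  exists (a + a'), (b + b'); split; [exact: (subringD sP)|exact: (subringD sP)| |].
    by rewrite eh eh'; ring.
  by rewrite (leq_trans (size_polyD _ _)) // geq_max sh.
have AM s t : S s -> A t -> A (s * t).
  move=> Ss [h [a [b [Sa Sb eh sh]]] <-].
  exists (s *: h); last by rewrite coefZ.
  exists (s *: a), (s *: b); split; try exact: polyinZ.
    by rewrite eh -!mul_polyC; ring.
  by rewrite (leq_trans (size_scale_leq _ _)).
have H h j : (j <= d)%N -> I h -> A h`_j.
  have [m] := ubnP (d - j); elim: m h j => // m IH h j; rewrite ltnS => jm jd Ih.
  move: jd; rewrite leq_eqVlt => /predU1P[->|jd]; first by exists h.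
  pose h' := 'X * h - h`_d *: f.
  have Ih' : I h'.
    have Sh := SI _ Ih; have [a [b [Sa Sb eh sh]]] := Ih.
    exists ('X * a - (h`_d)%:P), ('X * b); split.
    - by apply: (subringB sP); [apply: (subringM sP) => //; apply: polyinX|apply: polyinC].
    - by apply: (subringM sP) => //; apply: polyinX.
    - by rewrite /h' -mul_polyC {1}eh; ring.
    apply/leq_sizeP => i; rewrite leq_eqVlt => /predU1P[<-|di].
      by rewrite coefB coefXM coefZ (coef_monic mf sf) mulr1 subrr.
    rewrite coefB coefXM coefZ; case: i di => // i di.
    by rewrite [h`_i]nth_default ?(leq_trans sh) // [f`_ _]nth_default ?sf // mulr0 subr0.
  (* Up to a multiple of the top coefficient, index [j] is traded for [j.+1]; the induction on
     [d - j] ends at [d]. *)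
  have -> : h`_j = h'`_j.+1 + f`_j.+1 * h`_d.
    by rewrite coefB coefXM coefZ /= mulrC subrK.
  apply: AD; last by apply: AM => //; exists h.
  by apply: IH => //; rewrite (leq_trans _ jm) // ltn_sub2l.
have Ig : I g.
  exists 0, 1; split=> //; [exact: (subring0 sP)|exact: (subring1 sP)|ring].
have [h [a [b [Sa Sb eh sh]]] hd] := AM _ _ Sc (H g k kd Ig).
by exists a, b; rewrite -eh hd.
Qed.

(* Modulo the ideal [K] the monic [f] of positive degree is invertible, so [K] is the unit ideal. *)
Lemma monic_unit_mod S (K : L -> Prop) f h d : subring S ->
  K 0 -> (forall x y, K x -> K y -> K (x + y)) -> (forall s x, S s -> K x -> K (s * x)) ->
  f \is monic -> size f = d.+2 -> polyin S f -> polyin S h ->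
  (forall k, K (h * f - 1)`_k) -> K 1.
Proof.
move=> sS K0 KD KM mf sf Sf Sh Khf.
have KN x : K x -> K (- x) by move=> Kx; rewrite -mulN1r; apply: KM => //; apply: (subringN sS); apply: (subring1 sS).
have Ksum (I : finType) (P : pred I) (F : I -> L) : (forall i, P i -> K (F i)) -> K (\sum_(i | P i) F i).
  by move=> KF; apply: big_ind.
(* Descending induction on [m]: the coefficient of [h * f] at [m + d.+1] is [h_m] plus multiples of
   the [h_i] with [i > m], and 1 does not contribute since this index is positive. *)
have Kh m : K h`_m.
  have [n] := ubnP (size h - m); elim: n m => // n IH m; rewrite ltnS => hm.
  have [sm|ms] := leqP (size h) m; first by rewrite nth_default.
  have := Khf (m + d.+1)%N; rewrite coefB coef1 addnS /= subr0 coefM.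
  have lm : (m < (m + d).+2)%N by rewrite -addnS -addSn leq_addr.
  rewrite (bigD1 (Ordinal lm)) //= (_ : ((m + d).+1 - m)%N = d.+1); last by rewrite -addnS addKn.
  rewrite (coef_monic mf sf) mulr1 => Ks.
  rewrite -[h`_m](addrK (\sum_(i < (m + d).+2 | i != Ordinal lm) h`_i * f`_((m + d).+1 - i))).
  apply: (KD) => //; apply: KN; apply: Ksum => i; rewrite -val_eqE /= neq_ltn => /orP[im|mi].
    rewrite [f`_ _]nth_default ?mulr0 // sf.
    by rewrite ltn_subRL addnS ltnS ltn_add2r.
  rewrite mulrC; apply: KM => //; apply: IH; apply: leq_trans hm.
  by apply: ltn_sub2l.
have := Khf 0%N; rewrite coefB coef1 /= coefM big_ord1 /= => K1.
rewrite -[1](subKr (h`_0 * f`_0)); apply: KD; last exact: KN.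
by rewrite mulrC; apply: KM.
Qed.

(** Induction on the degree of the monic entry, over all coefficient rings at once because the step
    localizes. After reduction of the other entries modulo [v i 0], let [c] be a coefficient of some
    [v j 0]. Once [c] is inverted, the ideal of [v i 0] and [v j 0] contains a monic polynomial of
    degree [d]; it is used to make a third entry monic of that degree. Hence all such [c] lie in the
    Quillen ideal. *)
Theorem horrocks n d S (v : 'cV[{poly L}]_n) (w : 'rV[{poly L}]_n) (i : 'I_n) :
  (3 <= n)%N -> subring S -> (forall j, polyin S (v j 0)) -> (forall j, polyin S (w 0 j)) ->
  w *m v = 1%:M -> v i 0 \is monic -> size (v i 0) = d.+1 -> constant_mod_El S v.
Proof.
move=> n3; elim: d S v w i => [|d IH] S v w i sS Sv Sw wv mi si; have sP := subring_polyin sS.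
  have vi1 : v i 0 = 1.
    by rewrite (size1_polyC (eq_leq si)) (coef_monic mi si).
  pose p : 'cV[{poly L}]_n := \col_j (if j == i then 0 else - v j 0).
  have pi0 : p i 0 = 0 by rewrite mxE eqxx.
  apply: (@constant_mod_ElM _ _ _ _ _ (1%:M + p *m delta_mx 0 i)) => //.
    apply: El_addcol => // j; rewrite mxE; case: eqP => _; [exact: (subring0 sP)|exact: (subringN sP)].
  rewrite (_ : _ *m v = delta_mx i 0).
    move=> a b _ _; exists 1%:M; first exact: El1.
    by rewrite mul1mx /mx_subst !map_delta_mx.
  rewrite mulmxDl mul1mx -mulmxA -rowE; apply/matrixP => j k.
  rewrite !mxE big_ord1 !mxE !ord1 eqxx andbT vi1 mulr1.
  by case: eqP => [->|_]; rewrite ?addr0 ?subrr ?vi1.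
wlog sv : v w Sv Sw wv mi si / forall j, j != i -> (size (v j 0)%R <= d.+1)%N.
  move=> hw.
  have hq j : exists q, polyin S q /\ (size (v j 0%R - q * v i 0%R)%R < size (v i 0%R))%N.
    by have [q Sq sq] := polyin_divmod sS mi (Sv i) (Sv j); exists q.
  have [q Hq] := fin_all_exists hq.
  pose p : 'cV[{poly L}]_n := \col_j (if j == i then 0 else - q j).
  have pi0 : p i 0 = 0 by rewrite mxE eqxx.
  pose E := 1%:M + p *m delta_mx 0 i.
  have EE : El (polyin S) E.
    apply: El_addcol => // j; rewrite mxE; case: eqP => _; [exact: (subring0 sP)|apply: (subringN sP)].
    by case: (Hq j).
  have Ev j : (E *m v) j 0 = if j == i then v i 0 else v j 0 - q j * v i 0.
    rewrite mulmxDl mul1mx -mulmxA -rowE !mxE big_ord1 !mxE.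
    by case: eqP => [->|_]; rewrite ?mul0r ?addr0 ?mulNr.
  have [E' [EE' _ E'E]] := El_inv sP EE.
  apply: (constant_mod_ElM sS EE); apply: (hw _ (w *m E')).
  - move=> j; rewrite Ev; case: eqP => // _; apply: (subringB sP) => //; apply: (subringM sP) => //.
    by case: (Hq j).
  - by move=> j; rewrite mxE; apply: (subring_sum sP) => k _; apply: (subringM sP) => //; apply: (El_entry sP EE').
  - by rewrite mulmxA -(mulmxA w) E'E mulmx1.
  - by rewrite Ev eqxx.
  - by rewrite Ev eqxx.
  by move=> j ji; rewrite Ev (negPf ji); case: (Hq j) => _; rewrite si ltnS.
apply: quillen1 => //.
have K0 := quillen0 v sS; have KD := @quillenD _ _ _ S v; have KM := @quillenM _ _ _ S v.
have Kv j k : j != i -> quillen_power S v (v j 0)`_k.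
  move=> ji; apply: (quillen_loc n3 sS (Sv _ _)) => c0.
  set c := (v j 0)`_k in c0 *; have sl := subring_loc sS (Sv j k : S c).
  have sPl := subring_polyin sl.
  have kd : (k <= d)%N.
    by rewrite leqNgt; apply/negP => dk; case/eqP: c0; rewrite /c nth_default // (leq_trans (sv j ji)).
  have Svl l : polyin (loc S c) (v l 0) by apply: polyin_loc.
  have [a [b [Sa Sb sab abd]]] := monic_in_ideal sl mi si (Svl i) (Svl j) (sv j ji) kd (loc_inv sS c0) (mulVf c0).
  have [m mi' mj] := ord_avoid2 i j n3.
  (* Adding [t] times the combination with [d]-th coefficient 1 makes the [d]-th coefficient of
     entry [m] equal to 1. *)
  pose t : {poly L} := (1 - (v m 0)`_d)%:P.
  have St : polyin (loc S c) t.
    by apply: polyinC => //; apply: (subringB sl); [exact: (subring1 sl)|apply: sub_loc; exact: Sv].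
  pose q : 'rV[{poly L}]_n := \row_l (if l == i then t * a else if l == j then t * b else 0).
  have qm : q 0 m = 0 by rewrite mxE (negPf mi') (negPf mj).
  pose E := 1%:M + delta_mx m 0 *m q.
  have EE : El (polyin (loc S c)) E.
    apply: El_addrow => // l; rewrite mxE; case: eqP => _; first exact: (subringM sPl).
    by case: eqP => _; [exact: (subringM sPl)|exact: (subring0 sPl)].
  have qv : (q *m v) 0 0 = t * (a * v i 0 + b * v j 0).
    rewrite mxE (bigD1 i) //= (bigD1 j) //= !mxE eqxx (negPf ji) eqxx big1 => [|l /andP[li lj]].
      ring.
    by rewrite mxE (negPf li) (negPf lj) mul0r.
  have Ev l : (E *m v) l 0 = v l 0 + (if l == m then t * (a * v i 0 + b * v j 0) else 0).
    rewrite mulmxDl mul1mx -mulmxA -qv !mxE big_ord1 !mxE.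
    by case: eqP => _; rewrite ?mul1r ?mul0r.
  have [E' [EE' _ E'E]] := El_inv sPl EE.
  apply: (constant_mod_ElM sl EE).
  have [mm sm] : (E *m v) m 0 \is monic /\ size ((E *m v) m 0) = d.+1.
    apply: monic_of_coef; rewrite Ev eqxx.
      rewrite (leq_trans (size_polyD _ _)) // geq_max sv //.
      by rewrite mul_polyC (leq_trans (size_scale_leq _ _)).
    by rewrite coefD coefCM abd mulr1 addrC subrK.
  apply: (IH _ _ (w *m E') m) => //.
  - move=> l; rewrite Ev; apply: (subringD sPl) => //; case: eqP => _; last exact: (subring0 sPl).
    by apply: (subringM sPl) => //; apply: (subringD sPl); apply: (subringM sPl).
  - move=> l; rewrite mxE; apply: (subring_sum sPl) => k' _; apply: (subringM sPl); first exact: polyin_loc.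
    exact: (El_entry sPl EE').
  by rewrite mulmxA -(mulmxA w) E'E mulmx1.
(* Modulo the coefficients of the other entries, [w v = 1] says that [w 0 i * v i 0 = 1]. *)
apply: (monic_unit_mod (S := S) (f := v i 0) (h := w 0 i)) => //; [by move=> *; apply: KD|by move=> *; apply: KM|exact: si|].
move=> k; have: (w *m v) 0 0 = 1 by rewrite wv mxE.
rewrite mxE (bigD1 i) //= => <-; rewrite opprD addrA subrr sub0r coefN coef_sum.
rewrite -mulN1r; apply: (KM) => //; first by apply: (subringN sS); apply: (subring1 sS).
apply: (big_ind (quillen_power S v)) => // [x y|j ji]; first exact: KD.
rewrite coefM; apply: (big_ind (quillen_power S v)) => // [x y|l _]; first exact: KD.
by apply: KM; [exact: sS|exact: Sw|exact: Kv].
Qed.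

End Horrocks.

(** * Mennicke symbols *)

Section ThreeByThree.
Variable B : comNzRingType.

Definition i0 : 'I_3 := @Ordinal 3 0 isT.
Definition i1 : 'I_3 := @Ordinal 3 1 isT.
Definition i2 : 'I_3 := @Ordinal 3 2 isT.

Lemma ord3P (P : 'I_3 -> Prop) : P i0 -> P i1 -> P i2 -> forall i, P i.
Proof.
move=> P0 P1 P2 [[|[|[|//]]] lt]; first by rewrite (_ : Ordinal lt = i0) //; apply: val_inj.
  by rewrite (_ : Ordinal lt = i1) //; apply: val_inj.
by rewrite (_ : Ordinal lt = i2) //; apply: val_inj.
Qed.

Definition mx3 (a b c d e f g h k : B) : 'M[B]_3 :=
  \matrix_(i, j) nth 0 (nth [::] [:: [:: a; b; c]; [:: d; e; f]; [:: g; h; k]] i) j.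

Lemma mx3M a b c d e f g h k a' b' c' d' e' f' g' h' k' :
  mx3 a b c d e f g h k *m mx3 a' b' c' d' e' f' g' h' k' =
  mx3 (a * a' + b * d' + c * g') (a * b' + b * e' + c * h') (a * c' + b * f' + c * k')
     (d * a' + e * d' + f * g') (d * b' + e * e' + f * h') (d * c' + e * f' + f * k')
     (g * a' + h * d' + k * g') (g * b' + h * e' + k * h') (g * c' + h * f' + k * k').
Proof.
by apply/matrixP; apply: ord3P; apply: ord3P; rewrite !mxE !big_ord_recr big_ord0 /= !mxE /= add0r.
Qed.

Lemma mx3_1 : 1%:M = mx3 1 0 0 0 1 0 0 0 1.
Proof. by apply/matrixP; apply: ord3P; apply: ord3P; rewrite !mxE. Qed.

Lemma mx3_eta (M : 'M[B]_3) :
  M = mx3 (M i0 i0) (M i0 i1) (M i0 i2) (M i1 i0) (M i1 i1) (M i1 i2) (M i2 i0) (M i2 i1) (M i2 i2).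
Proof. by apply/matrixP; apply: ord3P; apply: ord3P; rewrite !mxE. Qed.

Lemma elem_mx3 (i j : 'I_3) (a : B) : elem i j a = mx3
  (1 + a *+ ((i == i0) && (j == i0))) (a *+ ((i == i0) && (j == i1))) (a *+ ((i == i0) && (j == i2)))
  (a *+ ((i == i1) && (j == i0))) (1 + a *+ ((i == i1) && (j == i1))) (a *+ ((i == i1) && (j == i2)))
  (a *+ ((i == i2) && (j == i0))) (a *+ ((i == i2) && (j == i1))) (1 + a *+ ((i == i2) && (j == i2))).
Proof.
rewrite {1}[elem i j a]mx3_eta !mxE /= !add0r !mulr_natr.
by rewrite !(eq_sym i) !(eq_sym j).
Qed.

Variable T : B -> Prop.
Hypothesis sT : subring T.

Definition sl2_block (a b c d : B) := mx3 a b 0 c d 0 0 0 1.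

Lemma mx3_congr a b c d e f g h k a' b' c' d' e' f' g' h' k' :
  a = a' -> b = b' -> c = c' -> d = d' -> e = e' -> f = f' -> g = g' -> h = h' -> k = k' ->
  mx3 a b c d e f g h k = mx3 a' b' c' d' e' f' g' h' k'.
Proof. by do 9!move->. Qed.

(* Equality of Mennicke symbols [[f1 f2, g] = [f1, g] [f2, g]], with the second factor placed
   in the coordinates 0 and 2. *)
Lemma mennicke_mul (f1 f2 g g' f' : B) : T f1 -> T f2 -> T g -> T g' -> T f' ->
  f1 * f2 * f' - g * g' = 1 ->
  exists E E', [/\ El T E, El T E' & sl2_block (f1 * f2) g g' f' =
     E *m (sl2_block f1 g g' (f2 * f') *m mx3 f2 0 g 0 1 0 g' 0 (f1 * f')) *m E'].
Proof.
move=> Tf1 Tf2 Tg Tg' Tf' det1.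
have T1 := subring1 sT; have TN := subringN sT; have TM := subringM sT.
exists (elem i1 i2 1 *m elem i2 i1 (-1) *m elem i1 i2 1 *m
        elem i2 i0 (- (g' * f')) *m elem i2 i1 (f1 * f')).
exists (elem i1 i2 (- f1) *m elem i2 i0 (g' * f2) *m elem i2 i1 (f2 * f')).
split.
- by do !apply: El_mul; apply: El_elem => //; auto.
- by do !apply: El_mul; apply: El_elem => //; auto.
rewrite !elem_mx3 /= !mulr0n !mulr1n /sl2_block !mx3M.
have e : f1 * f2 * f' = 1 + g * g' by rewrite -det1; ring.
apply: mx3_congr; ring: e.
Qed.

(** In coordinates 0 and 2, a column operation replaces [g] by the unit [g0]. Then [t = (1 - x) k]
    is chosen so that [x + g0 t = 1], and a determinant-one block with corner 1 is a product of two
    elementary matrices. *)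
Lemma El_unit_corner x g y z g0 g1 k : T x -> T g -> T y -> T z -> T g0 -> T g1 -> T k ->
  g = g0 + x * g1 -> k * g0 = 1 -> x * z - g * y = 1 ->
  El T (mx3 x 0 g 0 1 0 y 0 z).
Proof.
move=> Tx Tg Ty Tz Tg0 Tg1 Tk eg ek det1.
have T1 := subring1 sT; have TN := subringN sT; have TM := subringM sT; have TD := subringD sT; have TB := subringB sT.
pose z1 := z - y * g1; pose t := (1 - x) * k; pose y1 := y + z1 * t.
have ez : z1 = 1 + g0 * y1.
  have e1 : x * z1 - g0 * y = 1 by rewrite -det1 eg /z1; ring.
  have e2 : g0 * t = 1 - x by rewrite /t mulrC -mulrA ek mulr1.
  have -> : g0 * y1 = g0 * y + z1 * (g0 * t) by rewrite /y1; ring.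
  by rewrite e2 -{1}e1; ring.
have -> : mx3 x 0 g 0 1 0 y 0 z = elem i2 i0 y1 *m elem i0 i2 g0 *m elem i2 i0 (- t) *m elem i0 i2 g1.
  rewrite !elem_mx3 /= !mulr0n !mulr1n !mx3M.
  have e2 : g0 * t = 1 - x by rewrite /t mulrC -mulrA ek mulr1.
  have e3 : y1 * g0 = z1 - 1 by rewrite ez; ring.
  have e4 : z = z1 + y * g1 by rewrite /z1; ring.
  have e5 : y = y1 - z1 * t by rewrite /y1; ring.
  apply: mx3_congr; rewrite ?eg; try ring. 
  - by transitivity (1 - g0 * t); [rewrite e2|]; ring.
  - by transitivity ((1 - g0 * t) * g1 + g0); [rewrite e2|]; ring.
  - by transitivity (y1 - (y1 * g0 + 1) * t); [rewrite e3 subrK -e5|ring].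
  transitivity ((y1 - (y1 * g0 + 1) * t) * g1 + (y1 * g0 + 1)); last by ring.
  by rewrite e3 subrK -e5 addrC.
have Tt : T t by apply: (TM) => //; apply: (TB).
have Ty1 : T y1 by apply: (TD) => //; apply: (TM) => //; apply: (TB) => //; apply: (TM).
by do !apply: El_mul; apply: El_elem => //; auto.
Qed.

End ThreeByThree.

Section SL2.
Variable L : fieldType.
Implicit Types (S : L -> Prop) (f g : {poly L}) (c : L).

Definition sl2_in S f g g' f' :=
  [/\ polyin S f, polyin S g, polyin S g', polyin S f' & f * f' - g * g' = 1].

Lemma sl2_block_inv (a b c d : {poly L}) : a * d - b * c = 1 ->
  sl2_block a b c d *m sl2_block d (- b) (- c) a = 1%:M /\ sl2_block d (- b) (- c) a *m sl2_block a b c d = 1%:M.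
Proof. by move=> e; rewrite !mx3M mx3_1; split; apply: mx3_congr; try ring; rewrite -e; ring. Qed.

Lemma sl2_block_in S (a b c d : {poly L}) : subring S -> polyin S a -> polyin S b -> polyin S c ->
  polyin S d -> forall k l, polyin S (sl2_block a b c d k l).
Proof.
move=> sS Sa Sb Sc Sd; have S0 := subring0 (subring_polyin sS); have S1 := subring1 (subring_polyin sS).
by do 2!apply: ord3P; rewrite mxE.
Qed.

(** [constant_mod_ElM] handles left factors. A right factor is moved to the left by
    [A E' = (A E' A^-1) A], whose bracket is elementary by normality. *)
Lemma sl2_block_equiv S f g g' f' E E' : subring S -> sl2_in S f g g' f' ->
  El (polyin S) E -> El (polyin S) E' ->
  constant_mod_El S (E *m sl2_block f g g' f' *m E') -> constant_mod_El S (sl2_block f g g' f').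
Proof.
move=> sS [Sf Sg Sg' Sf' det1] EE EE' H; have sP := subring_polyin sS.
have [AA' A'A] := sl2_block_inv det1; set A := sl2_block _ _ _ _ in AA' A'A H *.
set A' := sl2_block _ _ _ _ in AA' A'A.
apply: (@constant_mod_ElM _ _ _ _ _ (E *m (A *m E' *m A'))) => //.
  apply: El_mul => //; apply: El_conj => //; apply: sl2_block_in => //; exact: (subringN sP).
by rewrite -!mulmxA A'A mulmx1 mulmxA.
Qed.

Section Operations.
Variables (S : L -> Prop) (f g g' f' q : {poly L}).
Hypotheses (sS : subring S) (Sq : polyin S q) (A_in : sl2_in S f g g' f').
Let sP := subring_polyin sS.

Lemma sl2_col1 : sl2_in S f (g + q * f) g' (f' + q * g').
Proof.
case: A_in => Sf Sg Sg' Sf' det1; split=> //; try by apply: (subringD sP) => //; apply: (subringM sP).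
by rewrite -det1; ring.
Qed.

Lemma sl2_col0 : sl2_in S (f + q * g) g (g' + q * f') f'.
Proof.
case: A_in => Sf Sg Sg' Sf' det1; split=> //; try by apply: (subringD sP) => //; apply: (subringM sP).
by rewrite -det1; ring.
Qed.

Lemma sl2_row1 : sl2_in S f g (g' + q * f) (f' + q * g).
Proof.
case: A_in => Sf Sg Sg' Sf' det1; split=> //; try by apply: (subringD sP) => //; apply: (subringM sP).
by rewrite -det1; ring.
Qed.

Lemma sl2_row0 : sl2_in S (f + q * g') (g + q * f') g' f'.
Proof.
case: A_in => Sf Sg Sg' Sf' det1; split=> //; try by apply: (subringD sP) => //; apply: (subringM sP).
by rewrite -det1; ring.
Qed.

Let El_q i j : i != j -> El (polyin S) (elem i j q : 'M_3).
Proof. by move=> ij; apply: El_elem. Qed.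

Lemma const_col1 : constant_mod_El S (sl2_block f (g + q * f) g' (f' + q * g')) ->
  constant_mod_El S (sl2_block f g g' f').
Proof.
move=> H; apply: (sl2_block_equiv sS A_in (El1 3 _) (El_q (i := i0) (j := i1) isT)).
rewrite mul1mx elem_mx3 mx3M /= !mulr0n mulr1n; congr (constant_mod_El S _): H.
by apply: mx3_congr; ring.
Qed.

Lemma const_col0 : constant_mod_El S (sl2_block (f + q * g) g (g' + q * f') f') ->
  constant_mod_El S (sl2_block f g g' f').
Proof.
move=> H; apply: (sl2_block_equiv sS A_in (El1 3 _) (El_q (i := i1) (j := i0) isT)).
rewrite mul1mx elem_mx3 mx3M /= !mulr0n mulr1n; congr (constant_mod_El S _): H.
by apply: mx3_congr; ring.
Qed.

Lemma const_row1 : constant_mod_El S (sl2_block f g (g' + q * f) (f' + q * g)) ->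
  constant_mod_El S (sl2_block f g g' f').
Proof.
move=> H; apply: (sl2_block_equiv sS A_in (El_q (i := i1) (j := i0) isT) (El1 3 _)).
rewrite mulmx1 elem_mx3 mx3M /= !mulr0n mulr1n; congr (constant_mod_El S _): H.
by apply: mx3_congr; ring.
Qed.

Lemma const_row0 : constant_mod_El S (sl2_block (f + q * g') (g + q * f') g' f') ->
  constant_mod_El S (sl2_block f g g' f').
Proof.
move=> H; apply: (sl2_block_equiv sS A_in (El_q (i := i0) (j := i1) isT) (El1 3 _)).
rewrite mulmx1 elem_mx3 mx3M /= !mulr0n mulr1n; congr (constant_mod_El S _): H.
by apply: mx3_congr; ring.
Qed.

End Operations.
End SL2.

Section SL2Local.
Variable L : fieldType.
Implicit Types (S : L -> Prop) (f g : {poly L}) (c : L).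

Lemma poly_split (p : {poly L}) : exists q, p = q * 'X + (p`_0)%:P.
Proof.
elim/poly_ind: p => [|q c _]; first by exists 0; rewrite mul0r coef0 add0r.
by exists q; rewrite coefD coefMX coefC /= add0r.
Qed.

Lemma monic_add f (h : {poly L}) d : f \is monic -> size f = d.+1 -> (size h <= d)%N ->
  f + h \is monic /\ size (f + h) = d.+1.
Proof.
move=> mf sf sh; apply: monic_of_coef.
  by rewrite (leq_trans (size_polyD _ _)) // geq_max sf leqnn (leq_trans sh).
by rewrite coefD (coef_monic mf sf) [h`_d]nth_default ?addr0.
Qed.

Definition sl2_trivial_at d := forall S f g g' f', subring S -> sl2_in S f g g' f' ->
  f \is monic -> size f = d.+1 -> constant_mod_El S (sl2_block f g g' f').

Lemma sl2_trivial0 : sl2_trivial_at 0.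
Proof.
move=> S f g g' f' sS A_in mf sf; have sP := subring_polyin sS.
have [Sf Sg Sg' Sf' det1] := A_in.
have f1 : f = 1 by rewrite (size1_polyC (eq_leq sf)) (coef_monic mf sf).
apply: (@constant_mod_ElM _ _ _ _ _ (elem i1 i0 (- g'))) => //.
  by apply: El_elem => //; apply: (subringN sP).
have -> : elem i1 i0 (- g') *m sl2_block f g g' f' = elem i0 i1 g.
  have ef' : f' = 1 + g * g' by rewrite -det1 f1; ring.
  by rewrite !elem_mx3 mx3M /= !mulr0n !mulr1n; apply: mx3_congr; rewrite ?ef' ?f1; ring.
move=> a b Sa Sb; rewrite /cong !mx_subst_elem.
exists (elem i0 i1 ((g \Po b) - (g \Po a))); last by rewrite elemD // subrK.
by apply: El_elem => //; apply: (subringB sP); apply: polyin_comp.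
Qed.

(* Subtracting a multiple of [g] makes [f] divisible by [X]; the symbol [[X, g]] is trivial. *)
Lemma sl2_unit_const d S f g g' f' : sl2_trivial_at d -> subring S -> sl2_in S f g g' f' ->
  f \is monic -> size f = d.+2 -> (size g <= d.+1)%N -> S (g`_0)^-1 -> g`_0 != 0 ->
  constant_mod_El S (sl2_block f g g' f').
Proof.
move=> IH sS A_in mf sf sg Sk g0; have sP := subring_polyin sS.
have [Sf Sg Sg' Sf' det1] := A_in.
pose q := (- (f`_0 / g`_0))%:P.
have Sq : polyin S q by apply: polyinC => //; apply: (subringN sS); apply: (subringM sS).
apply: (const_col0 sS Sq A_in).
have := sl2_col0 sS Sq A_in; set h := f + q * g; set g1' := g' + _ => B_in.
have [mh sh] : h \is monic /\ size h = d.+2.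
  apply: monic_add => //; rewrite mul_polyC (leq_trans (size_scale_leq _ _)) //.
have [f1 eh] := poly_split h.
have h0 : h`_0 = 0 by rewrite coefD coefCM mulNr divfK // subrr.
rewrite h0 addr0 in eh.
have mf1 : f1 \is monic by rewrite monicE -(lead_coefMX f1) -eh -monicE.
have sf1 : size f1 = d.+1.
  by apply/eqP; rewrite -eqSS -sh eh size_mulX ?monic_neq0.
have [Sh _ Sg1' _ det1'] := B_in.
have Sf1 : polyin S f1 by move=> k; have := Sh k.+1; rewrite eh coefMX.
have [g1 eg] := poly_split g.
have Sg1 : polyin S g1 by move=> k; have := Sg k.+1; rewrite eg coefD coefMX coefC /= addr0.
have SX := polyinX sS.
rewrite eh in det1'.
(* The symbol of [f1 * 'X] splits. The factor of ['X] is elementary, because [g] is a unit modulo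
   ['X]; the factor of [f1], of degree [d], falls to the induction hypothesis. *)
have [E [E' [EE EE' e]]] := mennicke_mul sP Sf1 SX Sg Sg1' Sf' det1'.
have Ecorner : El (polyin S) (mx3 'X 0 g 0 1 0 g1' 0 (f1 * f')).
  apply: (@El_unit_corner _ _ sP _ _ _ _ (g`_0)%:P g1 (g`_0)^-1%:P) => //.
  - exact: (subringM sP).
  - exact: polyinC.
  - exact: polyinC.
  - by rewrite addrC mulrC -eg.
  - by rewrite -polyCM mulVf.
  by rewrite -det1'; ring.
rewrite eh; rewrite eh in B_in.
have [E0 [EE0 E0E E0E']] := El_inv sP EE.
have [F0 [FE0 F0F F0F']] := El_inv sP (El_mul Ecorner EE').
apply: (sl2_block_equiv sS B_in EE0 FE0).
rewrite e !mulmxA E0E' mul1mx -!mulmxA (mulmxA _ E') F0F mulmx1.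
apply: IH => //; split=> //; first exact: (subringM sP).
by rewrite -det1'; ring.
Qed.

(* After reducing [g] and [g'] modulo [f], the elements [g(0)] and [g(0) + f'(0)] are
   comaximal; inverting the first allows [sl2_unit_const] directly, inverting the second
   allows it after adding the second row to the first. *)
Theorem sl2_trivial d : sl2_trivial_at d.
Proof.
elim: d => [|d IH] S f g g' f' sS A_in mf sf; first exact: sl2_trivial0.
have sP := subring_polyin sS.
wlog sg : g f' A_in / (size g <= d.+1)%N.
  move=> hw; have [Sf Sg _ _ _] := A_in.
  have [q Sq sq] := polyin_divmod sS mf Sf Sg.
  apply: (const_col1 sS (subringN sP Sq) A_in); apply: hw; first exact: sl2_col1 (subringN sP Sq) A_in.
  by rewrite mulNr -ltnS -sf.
wlog sg' : g' f' A_in / (size g' <= d.+1)%N.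
  move=> hw; have [Sf _ Sg' _ _] := A_in.
  have [q Sq sq] := polyin_divmod sS mf Sf Sg'.
  apply: (const_row1 sS (subringN sP Sq) A_in); apply: hw; first exact: sl2_row1 (subringN sP Sq) A_in.
  by rewrite mulNr -ltnS -sf.
have [Sf Sg Sg' Sf' det1] := A_in.
(* The determinant bounds the degree of [f'], so that [g + f'] stays of smaller degree than [f]
   after the row addition below. *)
have sf' : (size f' <= d.+1)%N.
  have [->|nf'] := eqVneq f' 0; first by rewrite size_poly0.
  have e : f * f' = 1 + g * g' by rewrite -det1; ring.
  have := congr1 (size : {poly L} -> nat) e; rewrite size_monicM // sf => sz.
  have: ((d.+2 + size f').-1 <= maxn 1 (d.+1 + d.+1).-1)%N.
    rewrite sz (leq_trans (size_polyD _ _)) // size_poly1 geq_max leq_maxl /=.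
    rewrite leq_max; apply/orP; right; rewrite (leq_trans (size_polyMleq _ _)) //.
    by apply: (@leq_trans (d.+1 + d.+1).-1) => //; rewrite -!subn1 leq_sub2r // leq_add.
  by move: (size f') => s; lia.
set A := sl2_block f g g' f'; apply: quillen1 => //.
pose s := g`_0; pose u := g`_0 + f'`_0.
have A_loc c : S c -> sl2_in (loc S c) f g g' f' by move=> Sc; split=> //; exact: polyin_loc.
have Ss : S s by apply: Sg.
have Su : S u by apply: (subringD sS); [exact: Sg|exact: Sf'].
have Ks : quillen_power S A s.
  apply: quillen_loc => // s0; have sl := subring_loc sS Ss.
  apply: (sl2_unit_const IH sl (A_loc _ Ss)) => //; exact: loc_inv.
have Ku : quillen_power S A u.
  apply: quillen_loc => // u0; have sl := subring_loc sS Su.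
  have S1 : polyin (loc S u) 1 by apply: (subring1 (subring_polyin sl)).
  apply: (const_row0 sl S1 (A_loc _ Su)).
  have [mh sh] := monic_add mf sf sg'.
  have e0 : (g + f')`_0 = u by rewrite coefD.
  have := sl2_row0 sl S1 (A_loc _ Su); rewrite !mul1r => B_in.
  apply: (sl2_unit_const IH sl B_in) => //.
  - by rewrite (leq_trans (size_polyD _ _)) // geq_max sg.
  - by rewrite e0; apply: loc_inv.
  by rewrite e0.
(* The right-hand side is the determinant evaluated at 0. *)
have -> : 1 = f`_0 * u + (- (f`_0 + g'`_0)) * s.
  have e1 : f`_0 * f'`_0 - g`_0 * g'`_0 = 1 by rewrite -!coef0M -coefB det1 coef1.
  by rewrite -[LHS]e1 /u /s; ring.
by apply: quillenD => //; apply: quillenM => //; apply: (subringN sS); apply: (subringD sS); [exact: Sf|exact: Sg'].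
Qed.

End SL2Local.

(** * Stability for polynomial rings *)

Section ElWhole.
Variable B : comNzRingType.

Definition all_in (x : B) : Prop := True.

Definition column_transitive := forall n (v : 'cV[B]_n) (w : 'rV[B]_n) (i : 'I_n),
  (3 <= n)%N -> w *m v = 1%:M -> exists2 E, El all_in E & E *m v = delta_mx i 0.

Definition sl_elementary n := forall A : 'M[B]_n, \det A = 1 -> El all_in A.

Lemma subring_all : subring all_in. Proof. by split. Qed.

Lemma El_elemT n (i j : 'I_n) a : i != j -> El all_in (elem i j a).
Proof. by move=> ij; apply: El_elem. Qed.

Lemma El_invT n (E : 'M[B]_n) : El all_in E ->
  exists E', [/\ El all_in E', E *m E' = 1%:M & E' *m E = 1%:M].
Proof. exact: El_inv subring_all. Qed.

Lemma elem_delta n (i j : 'I_n) a : elem i j a *m delta_mx j 0 = delta_mx j 0 + a *: delta_mx i 0 :> 'cV[B]_n.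
Proof. by rewrite mulmxDl mul1mx -scalemxAl mul_delta_mx. Qed.

Lemma elem_delta0 n (i j k : 'I_n) a : j != k -> elem i j a *m delta_mx k 0 = delta_mx k 0 :> 'cV[B]_n.
Proof. by move=> jk; rewrite mulmxDl mul1mx -scalemxAl mul_delta_mx_0 // scaler0 addr0. Qed.

(** Changing coordinate absorbs a unit: [elem l k b] creates the entry [b * a = 1] at [l], which
    then clears the entry [a] at [k]. For [i = j] one passes through a third coordinate. *)
Lemma El_scaled_delta n (i j : 'I_n) (c d : B) : (3 <= n)%N -> d * c = 1 ->
  exists2 E, El all_in E & E *m (c *: delta_mx i 0) = delta_mx j 0 :> 'cV[B]_n.
Proof.
move=> n3 dc.
have step (k l : 'I_n) (a b : B) : k != l -> b * a = 1 ->
    exists2 E, El all_in E & E *m (a *: delta_mx k 0) = delta_mx l 0 :> 'cV[B]_n.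
  move=> kl ba; exists (elem k l (- a) *m elem l k b).
    by apply: El_mul; apply: El_elemT; rewrite // eq_sym.
  rewrite -mulmxA -scalemxAr elem_delta scalerDr scalerA mulrC ba scale1r mulmxDr.
  have lk : l != k by rewrite eq_sym.
  rewrite -scalemxAr (elem_delta0 _ _ lk) elem_delta.
  by rewrite addrC -addrA -scalerDl addNr scale0r addr0.
have [ij|ij] := eqVneq i j; last exact: step dc.
have [m mi _] := ord_avoid2 i j n3.
have [E EE e] := step i m c d (ltac:(by rewrite eq_sym)) dc.
have [F FE f] := step m j 1 1 (ltac:(by rewrite -ij)) (mulr1 1).
exists (F *m E); first exact: El_mul.
by rewrite -mulmxA e -f scale1r.
Qed.

Lemma column_transitive_unit n (v : 'cV[B]_n) (i j : 'I_n) c d : (3 <= n)%N -> d * c = 1 ->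
  (exists2 E, El all_in E & E *m v = c *: delta_mx i 0) ->
  exists2 E, El all_in E & E *m v = delta_mx j 0.
Proof.
move=> n3 dc [E EE e]; have [F FE f] := El_scaled_delta i j n3 dc.
by exists (F *m E); [exact: El_mul|rewrite -mulmxA e].
Qed.

(** Row [l] of the adjugate shows that column [l] of [A] is unimodular. Row operations turn this
    column into a basis vector, which then clears row [l] by column operations. *)
Lemma reduce_last n (A : 'M[B]_n) (l : 'I_n) : column_transitive -> (3 <= n)%N -> \det A = 1 ->
  exists E E', [/\ El all_in E, El all_in E' & let A' := E *m A *m E' in
    forall i, A' i l = (i == l)%:R /\ A' l i = (i == l)%:R].
Proof.
move=> tr n3 dA.
have wv : row l (\adj A) *m col l A = 1%:M.
  rewrite rowE colE mulmxA -(mulmxA _ (\adj A)) mul_adj_mx dA mulmx1 mul_delta_mx.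
  by apply/matrixP => a b; rewrite !mxE !ord1.
have [E EE Ev] := tr n _ _ l n3 wv.
have EAl i : (E *m A) i l = (i == l)%:R.
  by have := congr1 (fun M : 'cV_n => M i 0) Ev; rewrite colE mulmxA -colE !mxE eqxx andbT.
pose q : 'rV[B]_n := \row_j (if j == l then 0 else - (E *m A) l j).
have ql : q 0 l = 0 by rewrite mxE eqxx.
exists E, (1%:M + delta_mx l 0 *m q); split=> //.
  by apply: El_addrow => //; apply: subring_all.
move=> A' i; have eA' k j : A' k j = (E *m A) k j + (k == l)%:R * q 0 j.
  rewrite /A' mulmxDr mulmx1 mulmxA -colE mxE; congr (_ + _).
  by rewrite mxE big_ord1 mxE EAl.
rewrite !eA' EAl ql mulr0 addr0 eqxx mul1r; split=> //.
by rewrite [q 0 i]mxE; case: eqP => [->|_]; rewrite ?addr0 ?EAl ?eqxx // subrr.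
Qed.

Lemma El_sandwich n (E E' A : 'M[B]_n) : El all_in E -> El all_in E' ->
  El all_in (E *m A *m E') -> El all_in A.
Proof.
move=> EE EE' H; have [F [FE _ FEE]] := El_invT EE; have [F' [FE' EFE' _]] := El_invT EE'.
have -> : A = F *m (E *m A *m E') *m F'.
  by rewrite -!mulmxA EFE' mulmx1 mulmxA FEE mul1mx.
by apply: El_mul => //; apply: El_mul.
Qed.

Lemma det_El_sandwich n (E E' A : 'M[B]_n) : El all_in E -> El all_in E' ->
  \det (E *m A *m E') = \det A.
Proof. by move=> /El_det dE /El_det dE'; rewrite !det_mulmx dE dE' mul1r mulr1. Qed.

Lemma sl_elementary_succ n : column_transitive -> (3 <= n)%N -> sl_elementary n -> sl_elementary n.+1.
Proof.
move=> tr n3; rewrite -addn1 => H A dA.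
have n3' : (3 <= n + 1)%N by rewrite addn1 ltnW.
have [E [E' [EE EE' HA']]] := reduce_last (rshift n (0%R : 'I_1)) tr n3' dA.
apply: (El_sandwich EE EE'); move: HA'; set A' := _ *m E' => HA'.
have dA' : \det A' = 1 by rewrite det_El_sandwich.
clearbody A'.
have eA' : A' = block_mx (ulsubmx A') 0 0 1%:M.
  rewrite -{1}[A']submxK; congr block_mx; apply/matrixP => i j; rewrite !mxE ?(ord1 i) ?(ord1 j).
  - by have [-> _] := HA' (lshift 1 i); rewrite eq_lrshift.
  - by have [_ ->] := HA' (lshift 1 j); rewrite eq_lrshift.
  by have [-> _] := HA' (rshift n (0%R : 'I_1)); rewrite eqxx.
have: El all_in (ulsubmx A') by apply: H; move: dA'; rewrite {1}eA' det_ublock det1 mulr1.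
rewrite {2}eA'; elim=> [|i j a M _ IH ij _].
  by rewrite -scalar_mx_block; apply: El1.
have -> : block_mx (M *m elem i j a) 0 0 1%:M =
    block_mx M 0 0 1%:M *m elem (lshift 1 i) (lshift 1 j) a :> 'M_(n + 1).
  have -> : elem (lshift 1 i) (lshift 1 j) a = block_mx (elem i j a) 0 0 1%:M :> 'M_(n + 1).
    have ed : delta_mx (lshift 1 i) (lshift 1 j) = block_mx (delta_mx i j) 0 0 0 :> 'M[B]_(n + 1).
      by rewrite delta_mx_ushift delta_mx_lshift /block_mx row_mx0.
    rewrite /elem ed [1%:M in LHS]scalar_mx_block.
    by rewrite scale_block_mx add_block_mx !scaler0 !addr0.
  by rewrite mulmx_block !mulmx0 !mul0mx !addr0 mulmx1 add0r.
by apply: ElR => //; rewrite eq_lshift.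
Qed.

Lemma sl_elementary_ge3 n : column_transitive -> sl_elementary 3 -> (3 <= n)%N -> sl_elementary n.
Proof.
move=> tr H3; elim: n => // n IH; rewrite leq_eqVlt => /predU1P[<- //|n3].
by apply: sl_elementary_succ => //; apply: IH.
Qed.

Lemma sl2_block_det (a b c d : B) : \det (sl2_block a b c d) = a * d - b * c.
Proof.
rewrite (expand_det_col _ i0) !big_ord_recr big_ord0 /= /cofactor.
rewrite !(expand_det_col _ ord0) !big_ord_recr !big_ord0 /= /cofactor !det_mx11.
by rewrite !mxE /= !(expr0, expr1, expr2); ring.
Qed.

Lemma sl_elementary3 : column_transitive ->
  (forall a b c d : B, a * d - b * c = 1 -> El all_in (sl2_block a b c d)) -> sl_elementary 3.
Proof.
move=> tr H A dA; have [E [E' [EE EE' HA']]] := reduce_last i2 tr isT dA.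
apply: (El_sandwich EE EE'); move: HA'; set A' := _ *m E' => HA'.
have dA' : \det A' = 1 by rewrite det_El_sandwich.
clearbody A'.
have eA' : A' = sl2_block (A' i0 i0) (A' i0 i1) (A' i1 i0) (A' i1 i1).
  rewrite {1}[A']mx3_eta; apply: mx3_congr => //.
  - by case: (HA' i0).
  - by case: (HA' i1).
  - by case: (HA' i0).
  - by case: (HA' i1).
  by case: (HA' i2).
by rewrite eA'; apply: H; rewrite -sl2_block_det -eA'.
Qed.

End ElWhole.

(** * Base case of the induction: fields *)

Section FieldCase.
Variable F : fieldType.

Lemma column_transitive_field : column_transitive F.
Proof.
move=> n v w j n3 wv.
have [i vi] : exists i, v i 0 != 0.
  apply/existsP; rewrite -negb_forall; apply/negP => /forallP v0.
  have: (w *m v) 0 0 = 0 by rewrite mxE big1 // => k _; rewrite (eqP (v0 k)) mulr0.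
  by rewrite wv mxE => /eqP; rewrite oner_eq0.
pose p : 'cV[F]_n := \col_k (if k == i then 0 else - (v k 0 / v i 0)).
have pi : p i 0 = 0 by rewrite mxE eqxx.
apply: (column_transitive_unit (i := i) (c := v i 0) j n3 (mulVf vi)).
exists (1%:M + p *m delta_mx 0 i); first by apply: El_addcol => //; apply: subring_all.
rewrite mulmxDl mul1mx -mulmxA -rowE; apply/matrixP => k l.
rewrite !mxE big_ord1 !mxE !ord1 eqxx andbT.
by case: eqP => [->|_]; rewrite ?mul0r ?addr0 ?mulr1 // mulNr divfK // subrr mulr0.
Qed.

Lemma sl_elementary_field : sl_elementary F 3.
Proof.
apply: sl_elementary3 column_transitive_field _.
have main a b c d : a * d - b * c = 1 -> b != 0 -> El (@all_in F) (sl2_block a b c d).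
  move=> e b0; have sT := subring_all F; rewrite -[a]mul1r in e *.
  (* Factoring [a] as [1 * a] transfers the block to coordinates 0 and 2, where the unit [b] makes
     it elementary. *)
  have [E [E' [EE EE' ->]]] := @mennicke_mul F _ sT 1 a b c d I I I I I e.
  apply: El_mul => //; apply: El_mul => //; apply: El_mul.
    have -> : sl2_block 1 b c (a * d) = elem i1 i0 c *m elem i0 i1 b.
      have ead : a * d = 1 + b * c by rewrite -e; ring.
      by rewrite !elem_mx3 mx3M /= !mulr0n !mulr1n ead; apply: mx3_congr; ring.
    by apply: El_mul; apply: El_elemT.
  apply: (@El_unit_corner F _ sT _ _ _ _ b 0 b^-1) => //; first by ring.
    by rewrite mulVf.
  by move: e; rewrite !mul1r.
move=> a b c d e; have [b0|b0] := eqVneq b 0; last exact: main.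
have d0 : d != 0 by apply/eqP => d0; move: e; rewrite b0 d0 => /eqP; rewrite mulr0 mul0r subr0 eq_sym oner_eq0.
have -> : sl2_block a b c d = elem i0 i1 (-1) *m sl2_block (a + c) (b + d) c d.
  by rewrite elem_mx3 mx3M /= !mulr0n !mulr1n; apply: mx3_congr; ring.
apply: El_mul; first exact: El_elemT.
by apply: main; [rewrite -e; ring|rewrite b0 add0r].
Qed.

End FieldCase.

(** * Nagata's change of variables *)

Section Nagata.

(** The one-sided inverse [psi] suffices to carry elementary factorizations back to the original
    variables. *)
Definition nagata (R : idomainType) := forall f : {poly R}, f != 0 ->
  exists (phi psi : {rmorphism {poly R} -> {poly R}}),
    cancel phi psi /\ exists u, u * lead_coef (phi f) = 1.

Lemma nagata_field (F : fieldType) : nagata F.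
Proof.
move=> f f0; exists idfun, idfun; split=> //; exists (lead_coef f)^-1.
by rewrite mulVf // lead_coef_eq0.
Qed.

Variable R : idomainType.

(* Substituting [x + y^N] for [x] makes the degree in [y] of the top coefficient dominate. *)
Lemma lead_coef_swap_shift (h : {poly {poly R}}) (N : nat) :
  h != 0 -> (sizeY h < N)%N ->
  lead_coef (swapXY (h \Po ('X + ('X^N)%:P))) = (lead_coef (lead_coef h))%:P.
Proof.
move=> h0 hN; have N0 : (0 < N)%N by apply: leq_trans hN.
have [d sh] : exists d, size h = d.+1.
  by exists (size h).-1; rewrite prednK // size_poly_gt0.
have lh : lead_coef h = h`_d by rewrite lead_coefE sh.
have hd : h`_d != 0 by rewrite -lh lead_coef_eq0.
pose G : {poly {poly R}} := 'X^N + 'X%:P.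
have sG : size G = N.+1.
  by rewrite size_polyDl size_polyXn // ltnS size_polyC polyX_eq0.
have mG : G \is monic.
  by rewrite monicE lead_coefDl ?lead_coefXn // size_polyXn ltnS size_polyC polyX_eq0.
have G0 : G != 0 by apply: monic_neq0.
pose F (i : nat) : {poly {poly R}} := map_poly polyC h`_i * G ^+ i.
have -> : swapXY (h \Po ('X + ('X^N)%:P)) = \sum_(i < d.+1) F i.
  rewrite comp_polyE raddf_sum sh; apply: eq_bigr => i _ /=.
  rewrite -mul_polyC rmorphM rmorphXn rmorphD /= swapXY_polyC swapXY_X swapXY_polyC.
  by rewrite map_polyXn addrC.
have sGX i : size (G ^+ i) = (N * i).+1.
  by rewrite -[LHS]prednK ?size_poly_gt0 ?expf_neq0 ?monic_neq0 // size_exp sG.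
have sterm i : h`_i != 0 -> size (F i) = (size (h`_i)%R + N * i)%N.
  move=> hi; rewrite /F size_mul ?map_polyC_eq0 ?expf_neq0 //.
  by rewrite size_map_polyC sGX addnS.
(* [F i] has size [size h_i + N i] with [size h_i <= N], so for [i < d] it is at most [N d], below
   the size of [F d]. *)
rewrite big_ord_recr /= lead_coefDr.
  have e : lead_coef (map_poly polyC h`_d) = (lead_coef h`_d)%:P.
    by apply: lead_coef_map_inj => //; apply: polyC_inj.
  by rewrite /F lead_coef_Mmonic ?monic_exp // e lh.
rewrite sterm // (@leq_ltn_trans (N * d)) //; last first.
  by rewrite -[ltnLHS]add0n ltn_add2r size_poly_gt0.
apply: (leq_trans (size_sum _ _ _)); apply/bigmax_leqP => i _.
have [hi0|hi] := eqVneq h`_i 0; first by rewrite /F hi0 rmorph0 mul0r size_poly0.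
rewrite sterm // (@leq_trans (N + N * i)) ?leq_add2r //.
  by rewrite (leq_trans (max_size_coefXY _ _)) // ltnW.
by rewrite -mulnS leq_mul2l ltn_ord orbT.
Qed.

(** The map given for [R], applied to coefficients, makes the leading coefficient of the leading
    coefficient a unit; shift and swap turn that unit into the leading coefficient itself. *)
Lemma nagata_poly : nagata R -> nagata {poly R}.
Proof.
move=> nag f f0; have [|phi [psi [phiK [u ulf]]]] := nag (lead_coef f).
  by rewrite lead_coef_eq0.
pose h := map_poly phi f; pose N := (sizeY h).+1.
pose g : {poly {poly R}} := ('X^N)%:P.
pose Phi : {rmorphism {poly {poly R}} -> {poly {poly R}}} :=
  swapXY \o (comp_poly ('X + g) \o map_poly phi).
pose Psi : {rmorphism {poly {poly R}} -> {poly {poly R}}} :=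
  map_poly psi \o (comp_poly ('X - g) \o swapXY).
exists Phi, Psi; split.
  move=> x; rewrite /Phi /Psi /= swapXYK -comp_polyA comp_polyD comp_polyX comp_polyC subrK comp_polyXr.
  by rewrite -map_poly_comp_id0 ?rmorph0 // map_poly_id // => c _; apply: phiK.
have lh : lead_coef h = phi (lead_coef f).
  by apply: lead_coef_map_inj; [apply: can_inj phiK|apply: rmorph0].
exists u%:P; rewrite /Phi /= lead_coef_swap_shift -/h ?ltnSn //.
  by rewrite lh -polyCM ulf.
by rewrite -lead_coef_eq0 lh raddf_eq0 ?lead_coef_eq0 //; apply: can_inj phiK.
Qed.

End Nagata.

(** * The inductive step from [R] to [{poly R}] *)

Section PolyStep.
Variable R : idomainType.
Notation K := {fraction R}.
Let iota : {rmorphism R -> K} := @tofrac R.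
Let S (x : K) := exists r, iota r = x.

Let iota_inj : injective iota.
Proof. by move=> x y /eqP; rewrite /iota /= tofrac_eq => /eqP. Qed.

Let sS : subring S.
Proof.
split=> [|_ _ [x <-] [y <-]|_ _ [x <-] [y <-]]; first by exists 1; rewrite rmorph1.
  by exists (x - y); rewrite rmorphB.
by exists (x * y); rewrite rmorphM.
Qed.

Let polyin_iota (p : {poly R}) : polyin S (map_poly iota p).
Proof. by move=> k; exists p`_k; rewrite coef_map. Qed.

Let polyin_lift (y : {poly K}) : polyin S y -> exists2 x, all_in x & map_poly iota x = y.
Proof.
move=> Sy; have [r Hr] := @fin_all_exists 'I_(size y) (fun _ => R) (fun i x => iota x = y`_i) (fun i => Sy i).
exists (\poly_(i < size y) (if insub i is Some j then r j else 0)) => //.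
apply/polyP => i; rewrite coef_map coef_poly; case: ltnP => h.
  by rewrite insubT /= Hr.
  by rewrite nth_default //; apply: (rmorph0 iota).
Qed.

Definition at0 n m (X : 'M[{poly R}]_(n, m)) : 'M[R]_(n, m) := map_mx (horner_eval 0) X.

(** Patching takes place over the fraction field, but its elementary matrices have coefficients in
    the image of [R]; they lift, and injectivity of [iota] brings the identity back. *)
Lemma constant_mod_El_descend n m (X : 'M[{poly R}]_(n, m)) :
  constant_mod_El S (map_mx (map_poly iota) X) ->
  exists2 E, El (@all_in _) E & X = E *m map_mx polyC (at0 X).
Proof.
move=> H; have [E' EE' e] := H 0 'X (subring0 (subring_polyin sS)) (polyinX sS).
have [E EE eE] := @El_lift _ _ (map_poly iota) n (@all_in _) (polyin S) E' polyin_lift EE'.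
exists E => //.
have inj : injective (map_mx (map_poly iota) : 'M_(n, m) -> 'M_(n, m)).
  have inj1 : injective (map_poly iota) by apply: map_inj_poly => //; apply: (rmorph0 iota).
  by move=> M N /matrixP eMN; apply/matrixP => i j; apply: inj1; have := eMN i j; rewrite !mxE.
apply: inj; rewrite map_mxM eE -[LHS]mx_substX e; congr (_ *m _).
apply/matrixP => i j; rewrite !mxE /= map_polyC /horner_eval -[0 in LHS]polyC0 comp_polyCr.
by rewrite -(rmorph0 iota) horner_map.
Qed.

Lemma map_mx_cancel n m (phi psi : {rmorphism {poly R} -> {poly R}}) (X : 'M_(n, m)) :
  cancel phi psi -> map_mx psi (map_mx phi X) = X.
Proof. by move=> phiK; apply/matrixP => i j; rewrite !mxE phiK. Qed.

Lemma El_mapT (B B' : comNzRingType) (f : {rmorphism B -> B'}) n (M : 'M[B]_n) :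
  El (@all_in _) M -> El (@all_in _) (map_mx f M).
Proof. exact: El_map. Qed.

(** After Nagata's substitution, scaling by [u] makes an entry monic. Horrocks reduces the column to
    its value at 0, a unimodular column over [R]. The scaling is undone at the end by
    [column_transitive_unit]. *)
Lemma column_transitive_poly : nagata R -> column_transitive R -> column_transitive {poly R}.
Proof.
move=> nag tr n v w j n3 wv.
have [i vi] : exists i, v i 0 != 0.
  apply/existsP; rewrite -negb_forall; apply/negP => /forallP v0.
  have: (w *m v) 0 0 = 0 by rewrite mxE big1 // => k _; rewrite (eqP (v0 k)) mulr0.
  by rewrite wv mxE => /eqP; rewrite oner_eq0.
have [phi [psi [phiK [u ulc]]]] := nag _ vi.
set c := lead_coef _ in ulc.
pose v1 := u%:P *: map_mx phi v; pose w1 := c%:P *: map_mx phi w.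
have wv1 : w1 *m v1 = 1%:M.
  rewrite -scalemxAl -scalemxAr scalerA -map_mxM wv map_mx1 -polyCM mulrC ulc polyC1 scale1r //.
have u0 : u != 0 by apply/eqP => u0; move/eqP: ulc; rewrite u0 mul0r eq_sym oner_eq0.
have mv1 : v1 i 0 \is monic.
  by rewrite !mxE mul_polyC monicE lead_coefZ ulc.
have [E EE eE] : exists2 E, El (@all_in _) E & v1 = E *m map_mx polyC (at0 v1).
  apply: constant_mod_El_descend.
  apply: (@horrocks _ _ (size (v1 i 0)).-1 S _ (map_mx (map_poly iota) w1) i) => //.
  - by move=> k; rewrite [in polyin _ _]mxE; apply: polyin_iota.
  - by move=> k; rewrite [in polyin _ _]mxE; apply: polyin_iota.
  - by rewrite -map_mxM wv1 map_mx1.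
  - by rewrite mxE monic_map.
  rewrite mxE /= (size_map_inj_poly iota_inj (rmorph0 iota)).
  by rewrite prednK // size_poly_gt0 monic_neq0.
have wv0 : at0 w1 *m at0 v1 = 1%:M by rewrite -map_mxM wv1 map_mx1.
have [E0 EE0 eE0] := tr n _ _ j n3 wv0.
have [E' [EE' _ E'E]] := El_invT EE.
have e1 : (map_mx polyC E0 *m E') *m v1 = delta_mx j 0.
  by rewrite -mulmxA eE (mulmxA E') E'E mul1mx -map_mxM eE0 map_delta_mx.
apply: (column_transitive_unit (i := j) (c := psi c%:P) (d := psi u%:P) _ n3).
  by rewrite -rmorphM -polyCM ulc !rmorph1.
exists (map_mx psi (map_mx polyC E0 *m E')).
  by apply: El_mapT; apply: El_mul => //; apply: El_mapT.
rewrite -{1}(map_mx_cancel v phiK) -map_mxM.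
have -> : map_mx phi v = c%:P *: v1.
  by rewrite /v1 scalerA -polyCM mulrC ulc polyC1 scale1r.
by rewrite -scalemxAr e1 map_mxZ map_delta_mx.
Qed.

Lemma sl_elementary_poly : nagata R -> column_transitive R -> sl_elementary R 3 ->
  sl_elementary {poly R} 3.
Proof.
move=> nag tr H; apply: sl_elementary3 (column_transitive_poly nag tr) _.
have main a b c d : a * d - b * c = 1 -> a != 0 -> El (@all_in {poly R}) (sl2_block a b c d).
  move=> e a0; have [phi [psi [phiK [u]]]] := nag _ a0.
  set l := lead_coef _ => ul.
  have ul' : u%:P * l%:P = 1 :> {poly R} by rewrite -polyCM ul.
  (* Multiplying the rows by [u] and by its inverse [l] makes the corner monic and keeps the
     determinant. The correcting diagonal matrix has entries in [R] and is elementary by [H]. *)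
  pose A := sl2_block (u%:P * phi a) (u%:P * phi b) (l%:P * phi c) (l%:P * phi d).
  have dA : u%:P * phi a * (l%:P * phi d) - u%:P * phi b * (l%:P * phi c) = 1.
    have := congr1 phi e; rewrite rmorphB !rmorphM rmorph1 => e'.
    rewrite -[RHS]mulr1 -{1}ul' -e'; ring.
  have mA : u%:P * phi a \is monic by rewrite mul_polyC monicE lead_coefZ ul.
  have [E EE eE] : exists2 E, El (@all_in _) E & A = E *m map_mx polyC (at0 A).
    apply: constant_mod_El_descend.
    have -> : map_mx (map_poly iota) A = sl2_block (map_poly iota (u%:P * phi a))
       (map_poly iota (u%:P * phi b)) (map_poly iota (l%:P * phi c)) (map_poly iota (l%:P * phi d)).
      by apply/matrixP; apply: ord3P; apply: ord3P; rewrite !mxE /= ?rmorph0 ?rmorph1.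
    apply: (@sl2_trivial _ (size (u%:P * phi a)).-1) => //.
    - split; try exact: polyin_iota.
      by rewrite -!rmorphM -rmorphB dA rmorph1.
    - by rewrite monic_map.
    rewrite (size_map_inj_poly iota_inj (rmorph0 iota)).
    by rewrite prednK // size_poly_gt0 monic_neq0.
  have EA : El (@all_in _) A.
    rewrite eE; apply: El_mul => //; apply: El_mapT; apply: H.
    by rewrite det_map_mx sl2_block_det dA rmorph1.
  have ED : El (@all_in _) (map_mx polyC (mx3 l 0 0 0 u 0 0 0 1)).
    apply: El_mapT; apply: H; have := sl2_block_det l 0 0 u; rewrite /sl2_block => ->.
    by rewrite mulr0 subr0 mulrC.
  rewrite -(map_mx_cancel (sl2_block a b c d) phiK); apply: El_mapT.
  suff -> : map_mx phi (sl2_block a b c d) = map_mx polyC (mx3 l 0 0 0 u 0 0 0 1) *m A by apply: El_mul.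
  have -> : map_mx polyC (mx3 l 0 0 0 u 0 0 0 1) = mx3 l%:P 0 0 0 u%:P 0 0 0 1.
    by apply/matrixP; apply: ord3P; apply: ord3P; rewrite !mxE.
  rewrite mx3M; transitivity (mx3 (phi a) (phi b) 0 (phi c) (phi d) 0 0 0 1).
    by apply/matrixP; apply: ord3P; apply: ord3P; rewrite !mxE /= ?rmorph0 ?rmorph1.
  by apply: mx3_congr; try ring; ring: ul'.
move=> a b c d e; have [a0|a0] := eqVneq a 0; last exact: main.
have b0 : b != 0 by apply/eqP => b0; move: e; rewrite a0 b0 => /eqP; rewrite !mul0r subr0 eq_sym oner_eq0.
have -> : sl2_block a b c d = sl2_block (a + b) b (c + d) d *m elem i1 i0 (-1).
  by rewrite elem_mx3 mx3M /= !mulr0n !mulr1n; apply: mx3_congr; ring.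
apply: El_mul; last exact: El_elemT.
by apply: main; [rewrite -e; ring|rewrite a0 add0r].
Qed.

End PolyStep.

(** * Iterated univariate polynomial rings *)

Section Tower.
Variable F : fieldType.

Fixpoint tower (k : nat) : idomainType := if k is k'.+1 then {poly tower k'} else F.

Lemma tower_suslin k :
  [/\ nagata (tower k), column_transitive (tower k) & sl_elementary (tower k) 3].
Proof.
elim: k => [|k [nag tr H]].
  by split; [exact: nagata_field|exact: column_transitive_field|exact: sl_elementary_field].
by split; [exact: nagata_poly|exact: column_transitive_poly|exact: sl_elementary_poly].
Qed.

Lemma tower_universal k : exists (iota : {rmorphism F -> tower k}) (x : 'I_k -> tower k),
  forall (A : comNzRingType) (f : {rmorphism F -> A}) (y : 'I_k -> A),
  exists g : {rmorphism tower k -> A}, (forall c, g (iota c) = f c) /\ forall i, g (x i) = y i.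
Proof.
elim: k => [|k [iota [x univ]]].
  exists idfun, (fun i => 0) => A f y; exists f; split=> // -[] //.
pose iota' : {rmorphism F -> {poly tower k}} := polyC \o iota.
exists iota', (fun i => if unlift ord_max i is Some j then (x j)%:P else 'X) => A f y.
have [g [gi gx]] := univ A f (fun i => y (lift ord_max i)).
have com : commr_rmorph g (y ord_max) by move=> a; apply: mulrC.
pose h : {rmorphism {poly tower k} -> A} := horner_morph com.
exists h; split=> [c|i]; first by rewrite /h /= horner_morphC gi.
by case: unliftP => [j|] ->; rewrite /h /= ?horner_morphC ?horner_morphX.
Qed.

(** The universal property of the tower yields a left inverse [g] of the evaluation [f], so a
    factorization of [f(A)] in the tower maps to one of [A]. *)
Theorem suslin_mpoly k n : (3 <= n)%N -> sl_elementary {mpoly F[k]} n.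
Proof.
move=> n3 A dA; have [_ tr H3] := tower_suslin k.
have H := sl_elementary_ge3 tr H3 n3.
have [iota [x univ]] := tower_universal k.
have [g [gi gx]] := univ {mpoly F[k]} (@mpolyC k F) (fun i => 'X_i).
pose f : {rmorphism {mpoly F[k]} -> tower k} := mmap iota x.
have gf p : g (f p) = p.
  rewrite [RHS]mpolyE /f /= /mmap rmorph_sum; apply: eq_bigr => m _.
  rewrite rmorphM gi mul_mpolyC; congr (_ *: _).
  rewrite /mmap1 rmorph_prod mpolyXE_id; apply: eq_bigr => i _.
  by rewrite rmorphXn gx.
have -> : A = map_mx g (map_mx f A) by apply/matrixP => i j; rewrite !mxE gf.
by apply: El_mapT; apply: H; rewrite det_map_mx dA rmorph1.
Qed.

End Tower.

(** * Gradient descent in Hilbert space *)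

Section InnerProduct.
Variables (V : lmodType CC) (dot : V -> V -> CC).
Hypothesis dotP : is_inner_product dot.
Implicit Types (u v w x y : V) (t : RR).

(** The real part gives the same norms and keeps all estimates in the ordered field [RR]. *)
Definition ip u v : RR := complex.Re (dot u v).
Definition rscale t u : V := (t%:C)%C *: u.
Local Notation "t *:: u" := (rscale t u) (at level 40).

Lemma dotDl u v w : dot (u + v) w = dot u w + dot v w.
Proof. by have [H _ _ _] := dotP; rewrite -[u]scale1r H mul1r scale1r. Qed.

Lemma ipDl u v w : ip (u + v) w = ip u w + ip v w.
Proof. by rewrite /ip dotDl; case: (dot u w) (dot v w) => [a b] [c d]. Qed.

Lemma ipC u v : ip u v = ip v u.
Proof. by have [_ H _ _] := dotP; rewrite /ip H; case: (dot v u). Qed.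

Lemma ip0l v : ip 0 v = 0.
Proof. by apply: (addrI (ip 0 v)); rewrite -ipDl !addr0. Qed.

Lemma ipZl t u v : ip (t *:: u) v = t * ip u v.
Proof.
have [H _ _ _] := dotP; rewrite /ip /rscale -[X in dot X _]addr0 H.
have -> : dot 0 v = 0 by apply: (addrI (dot 0 v)); rewrite -dotDl !addr0.
by rewrite addr0; case: (dot u v) => a b /=; rewrite mul0r subr0.
Qed.

Lemma ipNl u v : ip (- u) v = - ip u v.
Proof. by apply: (addIr (ip u v)); rewrite -ipDl !addNr ip0l. Qed.

Lemma ipDr u v w : ip w (u + v) = ip w u + ip w v.
Proof. by rewrite ipC ipDl !(ipC w). Qed.
Lemma ipZr t u v : ip v (t *:: u) = t * ip v u.
Proof. by rewrite ipC ipZl (ipC v). Qed.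
Lemma ipNr u v : ip v (- u) = - ip v u.
Proof. by rewrite ipC ipNl (ipC v). Qed.
Lemma ip0r v : ip v 0 = 0.
Proof. by rewrite ipC ip0l. Qed.

Definition ipE := (ipDl, ipDr, ipNl, ipNr, ipZl, ipZr).

Lemma ip_ge0 u : 0 <= ip u u.
Proof. by have [_ _ H _] := dotP; apply: H. Qed.

Lemma ip_eq0 u : ip u u = 0 -> u = 0.
Proof.
have [_ H _ H0] := dotP => e; apply: H0; move: e (H u u); rewrite /ip.
case: (dot u u) => a b /= -> [] /eqP; rewrite -addr_eq0 -mulr2n mulrn_eq0 /= => /eqP -> //.
Qed.

Lemma ip_suml (I : Type) (r : seq I) (P : pred I) (F : I -> V) v :
  ip (\sum_(i <- r | P i) F i) v = \sum_(i <- r | P i) ip (F i) v.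
Proof. by apply: (big_morph (fun u => ip u v)) => [u w|]; rewrite ?ipDl ?ip0l. Qed.

Lemma ip_sumr (I : Type) (r : seq I) (P : pred I) (F : I -> V) v :
  ip v (\sum_(i <- r | P i) F i) = \sum_(i <- r | P i) ip v (F i).
Proof. by rewrite ipC ip_suml; apply: eq_bigr => i _; rewrite ipC. Qed.

Lemma ip_norm_sqr u : ip_norm dot u ^+ 2 = ip u u.
Proof. by rewrite /ip_norm sqr_sqrtr //; apply: ip_ge0. Qed.

Lemma ip_norm_ge0 u : 0 <= ip_norm dot u.
Proof. exact: sqrtr_ge0. Qed.

Lemma cauchy_schwarz u v : ip u v <= ip_norm dot u * ip_norm dot v.
Proof.
set a := ip_norm dot u; set b := ip_norm dot v.
have a0 : 0 <= a by apply: ip_norm_ge0.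
have b0 : 0 <= b by apply: ip_norm_ge0.
have ea : ip u u = a ^+ 2 by rewrite ip_norm_sqr.
have eb : ip v v = b ^+ 2 by rewrite ip_norm_sqr.
have [b_eq0|bn0] := eqVneq b 0.
  have -> : v = 0 by apply: ip_eq0; rewrite eb b_eq0 expr0n.
  by rewrite ip0r mulr_ge0.
have [a_eq0|an0] := eqVneq a 0.
  have -> : u = 0 by apply: ip_eq0; rewrite ea a_eq0 expr0n.
  by rewrite ip0l mulr_ge0.
have ab : 0 < a * b by rewrite mulr_gt0 // lt_def ?an0 ?bn0.
(* This square equals [2 a b (a b - ip u v)]. *)
have := ip_ge0 (b *:: u - a *:: v).
rewrite !ipE (ipC v u) ea eb => h.
rewrite -(ler_pM2l ab); nra.
Qed.

Lemma ip_norm_triangle u v : ip_norm dot (u + v) <= ip_norm dot u + ip_norm dot v.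
Proof.
rewrite -(@ler_pXn2r _ 2) ?nnegrE ?addr_ge0 ?ip_norm_ge0 //.
rewrite sqrrD !ip_norm_sqr !ipE (ipC v u).
have := cauchy_schwarz u v; lra.
Qed.

End InnerProduct.

Lemma geometric_small (s e : RR) : 0 <= s -> s < 1 -> 0 < e ->
  exists N, forall n, (N <= n)%N -> s ^+ n < e.
Proof.
move=> s0 s1 e0.
(* A Bernoulli-type bound, which gives the decay without logarithms. *)
have B n : s ^+ n * (1 + n%:R * (1 - s)) <= 1.
  elim: n => [|n IH]; first by rewrite expr0 mul0r addr0 mulr1.
  apply: le_trans IH; rewrite exprS -mulrA [s * _]mulrC -mulrA ler_wpM2l ?exprn_ge0 //.
  rewrite -natr1 -subr_ge0.
  have -> : 1 + n%:R * (1 - s) - (1 + (n%:R + 1) * (1 - s)) * s = (n%:R + 1) * (1 - s) ^+ 2 by ring.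
  by rewrite mulr_ge0 ?sqr_ge0 ?addr_ge0.
have d0 : 0 < 1 - s by rewrite subr_gt0.
have k0 : 0 < e * (1 - s) by rewrite mulr_gt0.
have [N HN] : exists N : nat, (e * (1 - s))^-1 < N%:R.
  by exists (Num.bound (e * (1 - s))^-1); apply: archi_boundP; rewrite invr_ge0 ltW.
exists N => n Nn.
have h1 : 1 < n%:R * (e * (1 - s)).
  rewrite -ltr_pdivrMr // div1r; apply: lt_le_trans HN _; by rewrite ler_nat.
have h2 : 0 < 1 + n%:R * (1 - s) by apply: ltr_wpDr => //; rewrite mulr_ge0 // ltW.
rewrite -(ltr_pM2r h2); apply: le_lt_trans (B n) _.
rewrite mulrDr mulr1 mulrCA; apply: lt_trans h1 _; by rewrite ltrDr.
Qed.

Section GradientDescent.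
Variables (V : lmodType CC) (dot : V -> V -> CC).
Hypothesis dotP : is_inner_product dot.
Hypothesis dotC : ip_complete dot.
Implicit Types (u v w x y : V) (t : RR).
Local Notation ip := (ip dot).
Local Notation N := (ip_norm dot).
Local Notation "t *:: u" := (rscale t u) (at level 40).

Definition is_orthoproj (P : V -> V) :=
  [/\ forall a u v, P (a *: u + v) = a *: P u + P v,
      forall u v, ip (P u) v = ip u (P v) & forall u, P (P u) = P u].

Section OneProjection.
Variables (P : V -> V) (HP : is_orthoproj P).

Lemma projD u v : P (u + v) = P u + P v.
Proof. by have [L _ _] := HP; rewrite -[u]scale1r L !scale1r. Qed.
Lemma proj0 : P 0 = 0.
Proof. by apply: (addrI (P 0)); rewrite -projD !addr0. Qed.
Lemma projZ t u : P (t *:: u) = t *:: P u.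
Proof. by have [L _ _] := HP; rewrite /rscale -[_ *: u]addr0 L proj0 addr0. Qed.
Lemma projN u : P (- u) = - P u.
Proof. by apply: (addrI (P u)); rewrite -projD !subrr proj0. Qed.
Lemma projB u v : P (u - v) = P u - P v.
Proof. by rewrite projD projN. Qed.
Lemma proj_sym u v : ip (P u) v = ip u (P v). Proof. by case: HP. Qed.
Lemma proj_idem u : P (P u) = P u. Proof. by case: HP. Qed.
Lemma proj_ip u : ip (P u) (P u) = ip (P u) u.
Proof. by rewrite proj_sym proj_idem proj_sym. Qed.

Lemma proj_compl : is_orthoproj (fun u => u - P u).
Proof.
have [L S I] := HP; split=> [a u v|u v|u]; first by rewrite L scalerBr opprD addrACA.
  by rewrite !(ipDl dotP, ipDr dotP, ipNl dotP, ipNr dotP) S.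
by rewrite projB I subrr subr0.
Qed.

Lemma proj_pythagoras u : ip u u = ip (P u) (P u) + ip (u - P u) (u - P u).
Proof.
rewrite !(ipDl dotP, ipDr dotP, ipNl dotP, ipNr dotP) proj_ip (ipC dotP u (P u)); ring.
Qed.

Lemma proj_le u : ip (P u) (P u) <= ip u u.
Proof. by rewrite [leRHS]proj_pythagoras lerDl ip_ge0. Qed.

End OneProjection.

Variables (I : finType) (P : I -> V -> V).
Hypothesis HP : forall i, is_orthoproj (P i).
Let Q i u := u - P i u.
Let HQ i : is_orthoproj (Q i). Proof. exact: proj_compl. Qed.
Let D u := \sum_i Q i u.
Let f u := \sum_i ip (Q i u) (Q i u).

Variable delta : RR.
Hypotheses (d0 : 0 < delta) (d1 : delta <= 1) (I0 : (0 < #|I|)%N).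
Hypothesis gap : forall u, delta * f u <= ip (D u) (D u).

Let n : RR := #|I|%:R.
Let n1 : 1 <= n. Proof. by rewrite ler1n. Qed.
Let n0 : 0 < n. Proof. exact: lt_le_trans n1. Qed.

Let f_ge0 u : 0 <= f u.
Proof. by apply: sumr_ge0 => i _; apply: ip_ge0. Qed.

Let fE u : f u = ip (D u) u.
Proof. by rewrite ip_suml //; apply: eq_bigr => i _; rewrite (proj_ip (HQ i)). Qed.

Let D_sym u v : ip (D u) v = ip u (D v).
Proof. by rewrite ip_suml // ip_sumr //; apply: eq_bigr => i _; rewrite (proj_sym (HQ i)). Qed.

Let DD u v : D (u + v) = D u + D v.
Proof. by rewrite -big_split; apply: eq_bigr => i _; apply: projD (HQ i) _ _. Qed.

Let DZ t u : D (t *:: u) = t *:: D u.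
Proof. by rewrite /rscale scaler_sumr; apply: eq_bigr => i _; apply: projZ (HQ i) _ _. Qed.

Let fQ i u : ip (Q i u) (Q i u) <= f u.
Proof. by rewrite /f (bigD1 i) //= lerDl sumr_ge0 // => j _; apply: ip_ge0. Qed.

Let D_le u : ip (D u) (D u) <= n * f u.
Proof.
rewrite [X in X <= _]ip_suml //.
have -> : n * f u = \sum_i \sum_j (ip (Q i u) (Q i u) + ip (Q j u) (Q j u)) / 2.
  transitivity (\sum_i (n * ip (Q i u) (Q i u) + f u) / 2).
    by rewrite -mulr_suml big_split /= -mulr_sumr sumr_const -/(f u) -mulr_natl -/n; field.
  by apply: eq_bigr => i _; rewrite -mulr_suml big_split /= sumr_const -[_ *+ #|_|]mulr_natl.
apply: ler_sum => i _; rewrite ip_sumr //; apply: ler_sum => j _.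
move: (Q i u) (Q j u) => a b; have := ip_ge0 dotP (a - b).
rewrite !(ipDl dotP, ipDr dotP, ipNl dotP, ipNr dotP) (ipC dotP b); lra.
Qed.

Let f_D_le u : f (D u) <= n * ip (D u) (D u).
Proof.
rewrite /f; apply: (@le_trans _ _ (\sum_(i : I) ip (D u) (D u))).
  by apply: ler_sum => i _; apply: (proj_le (HQ i)).
by rewrite sumr_const -mulr_natl.
Qed.

Let step u := u + (- n^-1) *:: D u.
Let r := 1 - delta / n.

Let r0 : 0 <= r.
Proof. by rewrite subr_ge0 ler_pdivrMr // mul1r (le_trans d1). Qed.

Let r1 : r < 1.
Proof. by rewrite ltrBlDr ltrDl divr_gt0. Qed.

(** Here [f] is the quadratic form of [D], and [f (step u) = f u - 2 G / n + f (D u) / n^2] with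
    [G = ip (D u) (D u)]. As [f (D u) <= n G], the decrease is at least [G / n], hence at least
    [delta * f u / n] by [gap]. *)
Let f_step u : f (step u) <= r * f u.
Proof.
have := gap u; have := f_D_le u; rewrite !fE /step DD DZ.
rewrite (ipDl dotP) !(ipDr dotP) !(ipZl dotP) !(ipZr dotP) (D_sym (D u) u).
move: (ip (D (D u)) (D u)) (ip (D u) (D u)) (ip (D u) u) => H G A HG AG.
have m0 : 0 < n^-1 by rewrite invr_gt0.
have h1 : n^-1 * (n^-1 * H) <= n^-1 * G by rewrite ler_pM2l // ler_pdivrMl.
have h2 : n^-1 * (delta * A) <= n^-1 * G by rewrite ler_pM2l.
by rewrite /r; nra.
Qed.

Let step_dist u : N (step u - u) <= Num.sqrt (f u).
Proof.
rewrite /ip_norm; apply: ler_wsqrtr; rewrite -/(ip _ _) /step addrC addKr.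
rewrite !(ipZl dotP, ipZr dotP); have := D_le u.
have e : n^-1 * n = 1 by rewrite mulVf // gt_eqF.
have m0 : 0 < n^-1 by rewrite invr_gt0.
have m1 : n^-1 <= 1 by rewrite invf_le1.
have := f_ge0 u; move: (f u) (ip (D u) (D u)) => F G F0 FG.
have : n^-1 * G <= F by rewrite -[leRHS]mul1r -e -mulrA ler_pM2l.
move=> h; have : n^-1 * (n^-1 * G) <= n^-1 * F by rewrite ler_pM2l.
have : n^-1 * F <= F by rewrite -[leRHS]mul1r ler_wpM2r.
lra.
Qed.

Let iterate u m := iter m step u.
Let s := Num.sqrt r.

Let s0 : 0 <= s. Proof. exact: sqrtr_ge0. Qed.
Let s1 : s < 1. Proof. by rewrite -sqrtr1 ltr_sqrt. Qed.

Let f_iterate u m : Num.sqrt (f (iterate u m)) <= s ^+ m * Num.sqrt (f u).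
Proof.
elim: m => [|m IH]; first by rewrite mul1r.
apply: (@le_trans _ _ (s * Num.sqrt (f (iterate u m)))).
  by rewrite -sqrtrM //; apply: ler_wsqrtr; apply: f_step.
by rewrite exprS -mulrA ler_wpM2l.
Qed.

(** The step lengths are bounded by a geometric progression of ratio [s]; the factor [1 - s]
    telescopes its partial sums. *)
Let iterate_dist u m k :
  (1 - s) * N (iterate u (m + k) - iterate u m) <= s ^+ m * (1 - s ^+ k) * Num.sqrt (f u).
Proof.
elim: k => [|k IH].
  rewrite addn0 subrr expr0 subrr mulr0 mul0r.
  have -> : N 0 = 0 by rewrite /ip_norm -/(ip 0 0) ip0l // sqrtr0.
  by rewrite mulr0.
have tri : N (iterate u (m + k.+1) - iterate u m) <=
    N (iterate u (m + k).+1 - iterate u (m + k)) + N (iterate u (m + k) - iterate u m).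
  rewrite addnS -[X in N X <= _](subrKA (iterate u (m + k))).
  exact: ip_norm_triangle.
have st := le_trans (step_dist (iterate u (m + k))) (f_iterate u (m + k)).
have s1' : 0 <= 1 - s by rewrite subr_ge0 ltW.
apply: le_trans (ler_wpM2l s1' tri) _; rewrite mulrDr.
apply: le_trans (lerD (ler_wpM2l s1' st) IH) _.
by rewrite exprD exprS le_eqVlt; apply/orP; left; apply/eqP; ring.
Qed.

Theorem gradient_descent v : exists w, (forall i, P i w = w) /\
  (1 - s) * N (v - w) <= Num.sqrt (f v).
Proof.
set F := Num.sqrt (f v); have F0 : 0 <= F by apply: sqrtr_ge0.
have d : 0 < 1 - s by rewrite subr_gt0.
have dist m k : N (iterate v (m + k) - iterate v m) <= s ^+ m * (F / (1 - s)).
  rewrite mulrA ler_pdivlMr // mulrC; apply: le_trans (iterate_dist v m k) _.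
  rewrite ler_wpM2r // -[leRHS]mulr1 ler_wpM2l ?exprn_ge0 // lerBlDr lerDl.
  exact: exprn_ge0.
have NC a b : N (a - b) = N (b - a).
  rewrite /ip_norm -!/(ip _ _) -opprB !(ipNl dotP, ipNr dotP) opprK //.
have small e : 0 < e -> exists M, forall m, (M <= m)%N -> s ^+ m * (F / (1 - s)) < e.
  move=> e0; have c0 : 0 < F / (1 - s) + 1 by rewrite ltr_wpDl // divr_ge0 // ltW.
  have [M HM] := geometric_small s0 s1 (divr_gt0 e0 c0).
  exists M => m Mm; apply: (@le_lt_trans _ _ (s ^+ m * (F / (1 - s) + 1))).
    by rewrite ler_wpM2l ?exprn_ge0 // lerDl.
  by rewrite -ltr_pdivlMr // HM.
have [l Hl] : exists l, forall e : RR, 0 < e -> exists M : nat, forall m : nat,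
    (M <= m)%N -> N (iterate v m - l) < e.
  apply: dotC => e e0; have [M HM] := small e e0; exists M => m k Mm Mk.
  have [mk|/ltnW km] := leqP m k.
    by rewrite NC -(subnKC mk); apply: le_lt_trans (dist _ _) (HM _ Mm).
  by rewrite -(subnKC km); apply: le_lt_trans (dist _ _) (HM _ Mk).
exists l; split=> [i|].
  suff : N (Q i l) <= 0.
    rewrite le_eqVlt ltNge ip_norm_ge0 orbF => /eqP Nl.
    have : ip (Q i l) (Q i l) = 0 by rewrite -ip_norm_sqr // Nl expr0n.
    by move=> /(ip_eq0 dotP) /eqP; rewrite subr_eq0 => /eqP.
  apply/ler_addgt0Pr => e e0; rewrite add0r.
  have e2 : 0 < e / 2 by rewrite divr_gt0.
  have [M HM] := Hl _ e2.
  have c0 : 0 < F + 1 by rewrite ltr_wpDl.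
  have [M' HM'] := geometric_small s0 s1 (divr_gt0 e2 c0).
  pose m := maxn M M'; set um := iterate v m.
  have -> : Q i l = Q i um - Q i (um - l) by rewrite (projB (HQ i)) subKr.
  have le1 : N (- Q i (um - l)) <= e / 2.
    apply: le_trans (ltW (HM m (leq_maxl _ _))).
    rewrite /ip_norm; apply: ler_wsqrtr; rewrite -!/(ip _ _) !(ipNl dotP, ipNr dotP) opprK.
    exact: (proj_le (HQ i)).
  have le2 : N (Q i um) <= e / 2.
    apply: (@le_trans _ _ (s ^+ m * F)).
      by apply: le_trans (f_iterate v m); rewrite /ip_norm; apply: ler_wsqrtr; apply: fQ.
    apply: (@le_trans _ _ (s ^+ m * (F + 1))); first by rewrite ler_wpM2l ?exprn_ge0 // lerDl.
    by rewrite -ler_pdivlMr // ltW // HM' // leq_maxr.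
  by apply: le_trans (ip_norm_triangle dotP _ _) _; lra.
apply/ler_addgt0Pr => e e0; have [M HM] := Hl _ (divr_gt0 e0 d).
have := ip_norm_triangle dotP (v - iterate v M) (iterate v M - l).
rewrite subrKA => tri; have h := ltW (HM M (leqnn _)).
have := dist 0%N M; rewrite expr0 mul1r add0n NC => h'.
have s1' : 0 <= 1 - s by rewrite ltW.
apply: le_trans (ler_wpM2l s1' tri) _; rewrite mulrDr; apply: lerD.
  by rewrite mulrC -ler_pdivlMr.
by rewrite mulrC -ler_pdivlMr.
Qed.

End GradientDescent.

(** * The angle between subgroups *)

Section MoreInnerProduct.
Variables (V : lmodType CC) (dot : V -> V -> CC).
Hypothesis dotP : is_inner_product dot.

Lemma ip_normZ t (u : V) : 0 <= t -> ip_norm dot (rscale t u) = t * ip_norm dot u.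
Proof.
move=> t0; rewrite /ip_norm -!/(ip dot _ _) (ipZl dotP) (ipZr dotP) mulrA sqrtrM ?mulr_ge0 //.
by rewrite -expr2 sqrtr_sqr ger0_norm.
Qed.

Lemma ip_normB (u v : V) : ip_norm dot (u - v) = ip_norm dot (v - u).
Proof. by rewrite /ip_norm -!/(ip dot _ _) -opprB (ipNl dotP) (ipNr dotP) opprK. Qed.

End MoreInnerProduct.

Section PairInequality.
Variables (V : lmodType CC) (dot : V -> V -> CC).
Hypothesis dotP : is_inner_product dot.
Implicit Types (u v w x y : V) (c : RR).
Local Notation ip := (ip dot).
Local Notation "t *:: u" := (rscale t u) (at level 40).
Local Notation is_orthoproj := (is_orthoproj dot).
Let bil := (ipDl dotP, ipDr dotP, ipNl dotP, ipNr dotP, ipZl dotP, ipZr dotP).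

(** The bound concerns the complementary projections because their inner products are the cross
    terms of the squared Laplacian. *)
Definition pair_ineq c (P Q : V -> V) := forall x,
  - c * (ip (x - P x) (x - P x) + ip (x - Q x) (x - Q x)) <= 2 * ip (x - P x) (x - Q x).

Lemma pair_ineq_sym c P Q : pair_ineq c P Q -> pair_ineq c Q P.
Proof. by move=> H x; have := H x; rewrite addrC (ipC dotP (x - P x)). Qed.

(** The complementary projections commute too, so the inner product is the squared norm of their
    product applied to [x]. *)
Lemma proj_comm_ge0 P Q x : is_orthoproj P -> is_orthoproj Q ->
  P (Q x) = Q (P x) -> 0 <= ip (x - P x) (x - Q x).
Proof.
move=> HP HQ PQ.
have HP' := proj_compl dotP HP; have HQ' := proj_compl dotP HQ.
have e : (x - Q x) - P (x - Q x) = (x - P x) - Q (x - P x).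
  by rewrite (projB HP) (projB HQ) PQ !opprB addrACA [in RHS]addrACA; congr (_ + _); rewrite addrC.
rewrite -(proj_idem HP') (proj_sym HP') e -(proj_sym HQ') ?(proj_idem HQ').
rewrite -(proj_idem HQ') (proj_sym HQ'); exact: ip_ge0.
Qed.

(* [|x|^2] is bounded below by [2 t <x, a + b> - t^2 |a + b|^2], where [a = P x] and
   [b = Q x]; the best [t] in the extremal case is [(1 + c)^-1]. *)
Lemma pair_ineq_at c P Q x : is_orthoproj P -> is_orthoproj Q -> 0 < c -> c < 1 ->
  2 * ip (P x) (Q x) <= c * (ip (P x) (P x) + ip (Q x) (Q x)) ->
  - c * (ip (x - P x) (x - P x) + ip (x - Q x) (x - Q x)) <= 2 * ip (x - P x) (x - Q x).
Proof.
move=> HP HQ c0 c1 h; pose t := (1 + c)^-1.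
have := ip_ge0 dotP (x - t *:: (P x + Q x)).
have eP : ip x (P x) = ip (P x) (P x) by rewrite (proj_ip HP) (ipC dotP).
have eQ : ip x (Q x) = ip (Q x) (Q x) by rewrite (proj_ip HQ) (ipC dotP).
rewrite !bil !(ipC dotP _ x) (ipC dotP (Q x) (P x)) eP eQ.
move: h; move: (ip (P x) (P x)) (ip (Q x) (Q x)) (ip (P x) (Q x)) (ip x x) => a b r X h H.
have tc : t * (1 + c) = 1 by rewrite mulVf // gt_eqF // ltr_wpDl.
have t0 : 0 < t by rewrite invr_gt0 ltr_wpDl.
have H' : 2 * t * (a + b) - t * t * (a + b + 2 * r) <= X by lra.
have H2 : (2 + 2 * c) * (2 * t * (a + b) - t * t * (a + b + 2 * r)) <= (2 + 2 * c) * X.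
  by rewrite ler_pM2l //; lra.
have e2 : (2 + 2 * c) * (2 * t * (a + b) - t * t * (a + b + 2 * r)) =
    2 * (t * (1 + c)) * (2 * (a + b)  - t * (a + b + 2 * r)) by ring.
rewrite e2 tc mulr1 in H2.
have H3 : (1 + c) * (2 * (2 * (a + b)  - t * (a + b + 2 * r))) <= (1 + c) * ((2 + 2 * c) * X).
  by rewrite ler_pM2l //; lra.
have e3 : (1 + c) * (2 * (2 * (a + b)  - t * (a + b + 2 * r))) =
  4 * (1 + c) * (a + b) - 2 * (t * (1 + c)) * (a + b + 2 * r) by ring.
rewrite e3 tc mulr1 in H3.
(* Inserting [H3] bounds the target from below by [(1 - c) * (c * (a + b) - 2 * r)], which is
   nonnegative by [h']. *)
have d0 : 0 < 1 - c by rewrite subr_gt0.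
have h' := ler_wpM2l (ltW d0) h.
suff : 0 <= (1 + c) * (2 * (X - a - b + r) + c * (2 * X - a - b)).
  rewrite pmulr_rge0; last by lra.
  lra.
nra.
Qed.

End PairInequality.

(** * Averages over finite abelian groups and the Heisenberg estimate *)

Section Averages.
Variables (V : lmodType CC) (dot : V -> V -> CC).
Hypothesis dotP : is_inner_product dot.
Local Notation ip := (ip dot).
Local Notation is_orthoproj := (is_orthoproj dot).

Definition is_action (W : zmodType) (U : W -> V -> V) :=
  [/\ forall w a u v, U w (a *: u + v) = a *: U w u + U w v,
      forall w u v, dot (U w u) (U w v) = dot u v,
      forall u, U 0 u = u & forall w w' u, U (w + w') u = U w (U w' u)].

Section OneAction.
Variables (W : finZmodType) (U : W -> V -> V).
Hypothesis HU : is_action U.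

Lemma actD w u v : U w (u + v) = U w u + U w v.
Proof. by have [L _ _ _] := HU; rewrite -[u]scale1r L !scale1r. Qed.
Lemma act0 w : U w 0 = 0.
Proof. by apply: (addrI (U w 0)); rewrite -actD !addr0. Qed.
Lemma actZ w a u : U w (a *: u) = a *: U w u.
Proof. by have [L _ _ _] := HU; rewrite -[_ *: u]addr0 L act0 addr0. Qed.
Lemma act_sum w (I : Type) (r : seq I) (F : I -> V) :
  U w (\sum_(i <- r) F i) = \sum_(i <- r) U w (F i).
Proof. by apply: (big_morph (U w)); [exact: actD|exact: act0]. Qed.
Lemma act_add w w' u : U (w + w') u = U w (U w' u).
Proof. by case: HU. Qed.
Lemma act_zero u : U 0 u = u. Proof. by case: HU. Qed.
Lemma act_ip w u v : ip (U w u) v = ip u (U (- w) v).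
Proof.
have [_ D _ _] := HU.
by rewrite -[RHS]/(complex.Re _) -(D w) -act_add subrr act_zero.
Qed.

Definition average (u : V) : V := (#|W|%:R^-1)%:C%C *: \sum_w U w u.

Let cardW : (#|W|%:R : RR) != 0.
Proof. by rewrite pnatr_eq0 -lt0n; apply/card_gt0P; exists 0. Qed.

Lemma average_const u : (forall w, U w u = u) -> average u = u.
Proof.
move=> Uu; rewrite /average; under eq_bigr do rewrite Uu.
rewrite sumr_const -scaler_nat scalerA.
have -> : (#|W|%:R : CC) = (#|W|%:R)%:C%C by rewrite rmorph_nat.
by rewrite -rmorphM /= mulVf // scale1r.
Qed.

Lemma act_average w u : U w (average u) = average u.
Proof.
rewrite /average actZ act_sum; congr (_ *: _).
rewrite [RHS](reindex_inj (addrI w)) /=.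
by apply: eq_bigr => w' _; rewrite act_add.
Qed.

Lemma average_proj : is_orthoproj average.
Proof.
split=> [a u v|u v|u]; last 1 first.
- by apply: average_const => w; apply: act_average.
- rewrite /average scalerA mulrC -scalerA -scalerDr; congr (_ *: _).
  rewrite scaler_sumr -big_split; apply: eq_bigr => w _.
  by case: HU.
rewrite -!/(rscale _ _) (ipZl dotP) (ipZr dotP); congr (_ * _).
rewrite (ip_suml dotP) (ip_sumr dotP) [RHS](reindex_inj (@oppr_inj _)) /=.
by apply: eq_bigr => w _; rewrite act_ip.
Qed.

Lemma average_commute (T : V -> V) u :
  (forall a u v, T (a *: u + v) = a *: T u + T v) ->
  (forall w, T (U w u) = U w (T u)) -> T (average u) = average (T u).
Proof.
move=> L TU.
have T0 : T 0 = 0 by apply: (addrI (T 0)); rewrite -{1}[T 0]scale1r -L scale1r !addr0.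
have TD x y : T (x + y) = T x + T y by rewrite -[x]scale1r L !scale1r.
rewrite /average -[_ *: _]addr0 L T0 addr0; congr (_ *: _).
by rewrite (big_morph T TD T0); apply: eq_bigr => w _; apply: TU.
Qed.

Lemma average_near (e : RR) v : (forall w, ip_norm dot (U w v - v) <= e) ->
  ip_norm dot (v - average v) <= e.
Proof.
move=> H.
have -> : v - average v = rscale (#|W|%:R^-1) (\sum_w (v - U w v)).
  rewrite /rscale sumrB scalerBr; congr (_ - _).
  have eW : (#|W|%:R : CC) = (#|W|%:R)%:C%C by rewrite rmorph_nat.
  rewrite sumr_const -scaler_nat scalerA eW.
  by rewrite -rmorphM /= mulVf // scale1r.
have W0 : 0 < (#|W|%:R : RR) by rewrite lt_def cardW ler0n.
rewrite (ip_normZ dotP) ?invr_ge0 // ler_pdivrMl // mulr_natl -sumr_const.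
apply: (@le_trans _ _ (\sum_(w : W) ip_norm dot (v - U w v))).
  apply: (big_ind2 (fun x y => ip_norm dot x <= y)) => // [|x a y b xa yb].
    by rewrite /ip_norm -/(ip 0 0) (ip0l dotP) sqrtr0.
  by apply: le_trans (ip_norm_triangle dotP _ _) _; apply: lerD.
by apply: ler_sum => w _; rewrite (ip_normB dotP).
Qed.

End OneAction.

Lemma average_average_commute (W W' : finZmodType) (U : W -> V -> V) (U' : W' -> V -> V) u :
  is_action U -> is_action U' -> (forall w w' u, U w (U' w' u) = U' w' (U w u)) ->
  average U (average U' u) = average U' (average U u).
Proof.
move=> HU HU' C; apply: average_commute => // [|w]; first by case: (average_proj HU).
by apply/esym; apply: average_commute => //; case: HU'.
Qed.

(* [alpha], [beta] generate a Heisenberg group with centre [zeta]; off the [zeta]-invariant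
   vectors [PB PA PB = PB / p], and on them [PA] and [PB] commute. *)
Section Heisenberg.
Variables (p : nat) (W : finZmodType).
Variables (alpha : 'F_p -> V -> V) (beta zeta : W -> V -> V).
Variable (act : 'F_p -> W -> W).
Hypotheses (p_prime : prime p) (p5 : (5 <= p)%N).
Hypotheses (Ha : is_action alpha) (Hb : is_action beta) (Hz : is_action zeta).
Hypothesis act_inj : forall a, a != 0 -> injective (act a).
Hypothesis ba : forall a w u, beta w (alpha a u) = alpha a (zeta (act a w) (beta w u)).
Hypothesis az : forall a w u, alpha a (zeta w u) = zeta w (alpha a u).
Hypothesis bz : forall w w' u, beta w (zeta w' u) = zeta w' (beta w u).

Let PA := average alpha.
Let PB := average beta.
Let PZ := average zeta.
Let HA : is_orthoproj PA := average_proj Ha.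
Let HB : is_orthoproj PB := average_proj Hb.
Let HZ : is_orthoproj PZ := average_proj Hz.

Let AZ u : PA (PZ u) = PZ (PA u).
Proof. exact: average_average_commute. Qed.

Let BZ u : PB (PZ u) = PZ (PB u).
Proof. exact: average_average_commute. Qed.

(** Moving [beta w] past [alpha a] produces the central element [act a w]. For [a != 0] it runs once
    through [W], so the average over [beta] becomes the average over the centre. *)
Let conj_average a u : a != 0 -> PB (alpha a (PB u)) = alpha a (PZ (PB u)).
Proof.
move=> a0; rewrite {1}/PB {1}/average.
have -> : \sum_w beta w (alpha a (PB u)) = \sum_w alpha a (zeta (act a w) (PB u)).
  by apply: eq_bigr => w _; rewrite ba (act_average Hb).
rewrite -(act_sum Ha) -(actZ Ha) /PZ /average; congr (alpha a (_ *: _)).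
by rewrite [RHS](reindex_inj (act_inj a0)).
Qed.

Let card_p : (#|'F_p|%:R : RR) = p%:R.
Proof. by rewrite card_Fp. Qed.

Let p_gt0 : 0 < (p%:R : RR). Proof. by rewrite ltr0n prime_gt0. Qed.

(** In the average over [a] only [a = 0] survives, with weight [1 / p]; the other terms contain
    [PZ]. *)
Let PBAB u : PZ u = 0 -> PB (PA (PB u)) = rscale (p%:R^-1) (PB u).
Proof.
move=> zu; rewrite /PA /average card_p.
rewrite -/(rscale _ _) (projZ HB); congr (rscale _ _).
rewrite (big_morph PB (projD HB) (proj0 HB)) (bigD1 0) //= (act_zero Ha) (proj_idem HB).
rewrite big1 ?addr0 // => a a0.
by rewrite (conj_average _ a0) -BZ zu (proj0 HB) (act0 Ha).
Qed.

Definition heis_cos : RR := (Num.sqrt p%:R)^-1.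

Lemma heis_cos_gt0 : 0 < heis_cos.
Proof. by rewrite invr_gt0 sqrtr_gt0. Qed.

Lemma heis_cos_sqr : heis_cos ^+ 2 = p%:R^-1.
Proof. by rewrite exprVn sqr_sqrtr // ltW. Qed.

(** After squaring this is [4 / p < 1], where [p >= 5] enters. *)
Lemma heis_cos_lt : 2 * heis_cos < 1.
Proof.
rewrite -(@ltr_pXn2r _ 2) ?nnegrE ?mulr_ge0 ?ltW ?heis_cos_gt0 // expr1n exprMn heis_cos_sqr.
rewrite ltr_pdivrMr // mul1r -natrX ltr_nat; exact: leq_trans p5.
Qed.

Let ineq_offZ x : PZ x = 0 ->
  2 * ip (PA x) (PB x) <= heis_cos * (ip (PA x) (PA x) + ip (PB x) (PB x)).
Proof.
move=> zx; have c0 := heis_cos_gt0; set c := heis_cos in c0 *.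
have e1 : ip (PA x) (PB x) = ip (PA x) (PA (PB x)).
  by rewrite -(proj_sym HA) (proj_idem HA).
have e2 : ip (PA (PB x)) (PA (PB x)) = c ^+ 2 * ip (PB x) (PB x).
  rewrite (proj_ip HA) -{2}(proj_idem HB) -(proj_sym HB) (PBAB zx) (ipZl dotP) heis_cos_sqr.
  by [].
move: (PA (PB x)) e1 e2 => w; move: (PA x) (PB x) => u v e1 e2.
(* Here [w = PA (PB x)] has squared norm [c^2] times that of [v = PB x], and [ip u v = ip u w];
   expanding the square and dividing by [c] gives the claim. *)
have := ip_ge0 dotP (rscale c u - w).
rewrite !(ipDl dotP, ipDr dotP, ipNl dotP, ipNr dotP, ipZl dotP, ipZr dotP).
rewrite (ipC dotP w u) -e1 e2.
move: (ip u v) (ip u u) (ip v v) => r a b h.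
rewrite -(ler_pM2l c0); nra.
Qed.

(** [PA] and [PB] preserve the splitting of [x] into its central-invariant part [z] and the
    orthogonal part [e]. On [z] they commute; on [e] the cosine bound applies. *)
Lemma heisenberg_pair_ineq : pair_ineq dot heis_cos PA PB.
Proof.
move=> x; have c0 := heis_cos_gt0; set c := heis_cos in c0 *.
pose z := PZ x; pose e := x - z.
have ze : PZ e = 0 by rewrite /e (projB HZ) (proj_idem HZ) subrr.
have ortho u v : PZ u = u -> PZ v = 0 -> ip u v = 0.
  by move=> zu zv; rewrite -zu (proj_sym HZ) zv (ip0r dotP).
have zz : PZ z = z by apply: (proj_idem HZ).
have xA : x - PA x = (z - PA z) + (e - PA e).
  by rewrite -[in LHS](subrKC z x) (projD HA) opprD addrACA.
have xB : x - PB x = (z - PB z) + (e - PB e).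
  by rewrite -[in LHS](subrKC z x) (projD HB) opprD addrACA.
have zA : PZ (z - PA z) = z - PA z by rewrite (projB HZ) -AZ zz.
have zB : PZ (z - PB z) = z - PB z by rewrite (projB HZ) -BZ zz.
have eA : PZ (e - PA e) = 0 by rewrite (projB HZ) -AZ ze (proj0 HA) subrr.
have eB : PZ (e - PB e) = 0 by rewrite (projB HZ) -BZ ze (proj0 HB) subrr.
have comm : 0 <= ip (z - PA z) (z - PB z).
  apply: proj_comm_ge0 => //; apply: average_commute => // [|w].
    by case: HA.
  apply/esym; apply: average_commute => // [|a]; first by case: Hb.
  by rewrite ba -bz (_ : zeta _ z = z) //; apply: (act_average Hz).
have c1 : c < 1 by have := heis_cos_lt; have := heis_cos_gt0; rewrite /c; lra.
have := pair_ineq_at dotP HA HB c0 c1 (ineq_offZ ze).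
rewrite xA xB; move: (e - PA e) (e - PB e) eA eB => ea eb zea zeb.
move: (z - PA z) (z - PB z) zA zB comm => za zb zza zzb comm.
rewrite !(ipDl dotP) !(ipDr dotP) (ortho _ _ zza zea) (ortho _ _ zzb zeb) (ortho _ _ zza zeb).
rewrite (ipC dotP ea za) (ipC dotP eb zb) (ipC dotP ea zb) (ortho _ _ zza zea) (ortho _ _ zzb zeb) (ortho _ _ zzb zea).
have := ip_ge0 dotP za; have := ip_ge0 dotP zb.
nra.
Qed.

End Heisenberg.
End Averages.

(** * Generation and the spectral gap *)

Section Relations.
Variables (B : comNzRingType) (n : nat).
Implicit Types (i j k l : 'I_n) (a b : B).

Lemma elem_commute i j k l a b : j != k -> l != i ->
  elem i j a *m elem k l b = elem k l b *m elem i j a.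
Proof.
move=> jk li; rewrite /elem !(mulmxDl, mulmxDr) !(mul1mx, mulmx1) -!scalemxAl -!scalemxAr.
by rewrite !mul_delta_mx_0 // !scaler0 !addr0 -!addrA [_ *: _ + _]addrC.
Qed.

Lemma elem_heisenberg i j k a b : i != j -> j != k -> i != k ->
  elem i j a *m elem j k b = elem j k b *m elem i j a *m elem i k (a * b).
Proof.
move=> ij jk ik; have ji : j != i by rewrite eq_sym. have ki : k != i by rewrite eq_sym.
rewrite /elem; set U := a *: _; set V := b *: _; set W := _ *: delta_mx i k.
have UV : U *m V = W by rewrite -scalemxAl -scalemxAr scalerA mul_delta_mx.
have VU : V *m U = 0 by rewrite -scalemxAl -scalemxAr mul_delta_mx_0 // !scaler0.
have UW : U *m W = 0 by rewrite -scalemxAl -scalemxAr mul_delta_mx_0 // !scaler0.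
have VW : V *m W = 0 by rewrite -scalemxAl -scalemxAr mul_delta_mx_0 // !scaler0.
clearbody U V W; rewrite !(mulmxDl, mulmxDr, mul1mx, mulmx1, UV, VU, UW, VW, mul0mx, addr0).
by rewrite !addrA -!addrA; congr (_ + _); rewrite addrCA addrC -addrA.
Qed.

Lemma elem_commutator i j k a b : i != j -> j != k -> i != k ->
  elem i j a *m elem j k b *m elem i j (- a) *m elem j k (- b) = elem i k (a * b).
Proof.
move=> ij jk ik; have ki : k != i by rewrite eq_sym.
have ji : j != i by rewrite eq_sym. have kj : k != j by rewrite eq_sym.
have cA : elem i k (a * b) *m elem i j (- a) = elem i j (- a) *m elem i k (a * b) by apply: elem_commute.
have cB : elem i k (a * b) *m elem j k (- b) = elem j k (- b) *m elem i k (a * b) by apply: elem_commute.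
rewrite elem_heisenberg // -!mulmxA (mulmxA (elem i k _)) cA -!mulmxA cB.
rewrite (mulmxA (elem i j a)) elemD // subrr elem0 mul1mx mulmxA elemD // subrr elem0 mul1mx //.
Qed.

End Relations.

Lemma val_ordS n (i : 'I_n) : val (ordS i) = if (i.+1 < n)%N then i.+1 else 0.
Proof.
rewrite /=; case: ltnP => h; first by rewrite modn_small.
have -> : i.+1 = n by move: (ltn_ord i); lia.
exact: modnn.
Qed.

Lemma ordS_neq n (i : 'I_n) : (1 < n)%N -> i != ordS i.
Proof.
move=> n1; rewrite -val_eqE val_ordS /=; have ilt := ltn_ord i.
by case: (ltnP i.+1 n) => h; apply/eqP => e; lia.
Qed.

Lemma ordSS_neq n (i : 'I_n) : (2 < n)%N -> i != ordS (ordS i).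
Proof.
move=> n2; have e1 : nat_of_ord (ordS i) = if (i.+1 < n)%N then i.+1 else 0 := val_ordS i.
rewrite -val_eqE val_ordS e1; have ilt := ltn_ord i.
case: (ltnP i.+1 n) => h; case: ltnP => h'; apply/eqP => /= e; lia.
Qed.

(** * Generation by the root groups along the cycle *)

Section Generation.
Variables (p n k : nat).
Hypotheses (hp : prime p) (n3 : (3 <= n)%N).
Local Notation R := {mpoly 'F_p[k]}.

Variable K : 'M[R]_n -> Prop.
Hypotheses (K1 : K 1%:M) (KM : forall M N, K M -> K N -> K (M *m N)).

Let Kn i j (a : R) m : i != j -> K (elem i j a) -> K (elem i j (a *+ m)).
Proof.
move=> ij Ka; elim: m => [|m IH]; first by rewrite mulr0n elem0.
by rewrite mulrS -(elemD _ _ ij); exact: KM.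
Qed.

(** In characteristic [p] the inverse is the [(p - 1)]-st power, so closure under products is enough
    for commutators. *)
Let KN i j (a : R) : i != j -> K (elem i j a) -> K (elem i j (- a)).
Proof.
move=> ij Ka; have -> : - a = a *+ p.-1; last exact: Kn.
apply/eqP; rewrite eq_sym -addr_eq0 -mulrSr prednK ?prime_gt0 // -mulr_natr.
by rewrite -(rmorph_nat (@mpolyC k 'F_p)) pchar_Fp_0 // rmorph0 mulr0.
Qed.

Let Kcomm i j l (a b : R) : i != j -> j != l -> i != l ->
  K (elem i j a) -> K (elem j l b) -> K (elem i l (a * b)).
Proof.
move=> ij jl il Ka Kb; rewrite -(elem_commutator _ _ ij jl il).
by apply: (KM); [apply: (KM); [exact: KM|exact: KN]|exact: KN].
Qed.

(** Successive commutators lengthen the path from [i] along the cycle; the three indices stay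
    distinct until the path would close up. *)
Let Kones (i : 'I_n) : (forall i : 'I_n, K (elem i (ordS i) 1)) -> forall j, i != j -> K (elem i j 1).
Proof.
move=> H; have n0 : (0 < n)%N by apply: leq_trans n3.
have val_iter m : val (iter m (@ordS n) i) = ((i + m) %% n)%N.
  elim: m => [|m IH] /=; first by rewrite addn0 modn_small.
  by rewrite IH -addn1 modnDml addn1 addnS.
have neq m m' : (m < m')%N -> (m' < m + n)%N -> iter m (@ordS n) i != iter m' (@ordS n) i.
  move=> mm' m'n; rewrite -val_eqE !val_iter -(subnKC (ltnW mm')) addnA -{1}[(i + m)%N]addn0 eqn_modDl.
  by rewrite mod0n eq_sym modn_small ?ltn_subLR ?(ltnW mm') // -lt0n subn_gt0.
have step m : (m.+1 < n)%N -> K (elem i (iter m.+1 (@ordS n) i) 1).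
  elim: m => [|m IH] mn; first exact: H.
  rewrite -[1]mulr1; apply: (@Kcomm i (iter m.+1 (@ordS n) i)).
  - exact: (neq 0%N m.+1 isT (ltnW mn)).
  - by apply: neq => //; move: n3; lia.
  - exact: (neq 0%N m.+2 isT mn).
  - exact: IH (ltnW mn).
  exact: H.
move=> j ij; pose m := ((j + n - i) %% n)%N.
have ej : iter m (@ordS n) i = j.
  apply: val_inj; rewrite val_iter modnDmr subnKC ?modnDr ?modn_small //.
  by rewrite ltnW // ltn_addl.
have mn : (m < n)%N by rewrite ltn_mod.
case em : m => [|m']; first by move: ej ij; rewrite em /= => ->; rewrite eqxx.
by rewrite -ej em; apply: step; rewrite -em.
Qed.

(** Commutators with entries 1 move an entry to any position. The entries available everywhere are
    then closed under sums, and under products by a commutator through a third index. The predicate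
    [K] is general so as to cover both words in the generators and stabilizers of a vector. *)
Lemma gens_generate :
  (forall i : 'I_n, K (elem i (ordS i) 1)) ->
  (exists i : 'I_n, forall l, K (elem i (ordS i) 'X_l)) ->
  forall M, El (@all_in R) M -> K M.
Proof.
move=> H1 [r HX]; have ones i j : i != j -> K (elem i j 1) by move=> ij; apply: Kones.
have n0 : (0 < n)%N by apply: leq_trans n3.
have spread (u s : 'I_n) (a : R) : u != s -> K (elem u s a) -> forall i j, i != j -> K (elem i j a).
  move=> us Ka; have right i j l (b : R) : i != j -> i != l -> K (elem i j b) -> K (elem i l b).
    move=> ij il Kb; have [<- //|jl] := eqVneq j l.
    by rewrite -[b]mulr1; exact: (Kcomm ij jl il Kb (ones _ _ jl)).
  have left i j l (b : R) : i != j -> l != j -> K (elem i j b) -> K (elem l j b).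
    move=> ij lj Kb; have [<- //|il] := eqVneq i l; have li : l != i by rewrite eq_sym.
    by rewrite -[b]mul1r; exact: (Kcomm li ij lj (ones _ _ li) Kb).
  (* The position moves from [(u, s)] to [(u, m)], [(i, m)] and [(i, j)], changing one index at a
     time. *)
  move=> i j ij; have [m mr mi] := ord_avoid2 u i n3.
  have um : u != m by rewrite eq_sym. have im : i != m by rewrite eq_sym.
  exact: (right i m j a im ij (left u m i a um im (right u s m a us um Ka))).
pose U (a : R) := forall i j, i != j -> K (elem i j a).
have UD a b : U a -> U b -> U (a + b).
  by move=> Ua Ub i j ij; rewrite -(elemD _ _ ij); exact: KM (Ua _ _ ij) (Ub _ _ ij).
have UM a b : U a -> U b -> U (a * b).
  move=> Ua Ub i j ij; have [m mi mj] := ord_avoid2 i j n3.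
  have im : i != m by rewrite eq_sym.
  exact: (Kcomm im mj ij (Ua _ _ im) (Ub _ _ mj)).
have U0 : U 0 by move=> i j ij; rewrite elem0; exact: K1.
have U1 : U 1 by exact: ones.
have UC (c : 'F_p) : U c%:MP.
  move=> i j ij; rewrite -[c]natr_Zp rmorph_nat; exact: (Kn c ij (ones _ _ ij)).
have UX l : U 'X_l by exact: spread (ordS_neq r (ltnW n3)) (HX l).
have Uall a : U a.
  rewrite [a]mpolyE; apply: (big_ind U U0 UD) => m _; rewrite -mul_mpolyC.
  apply: (UM); first exact: UC.
  rewrite mpolyXE_id; apply: (big_ind U U1 UM) => l _.
  elim: (m l) => [|e IH]; first by rewrite expr0; exact: U1.
  by rewrite exprS; exact: UM (UX l) IH.
move=> M; elim=> [|i j a N _ KN' ij _]; first exact: K1.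
exact: KM KN' (Uall a _ _ ij).
Qed.

End Generation.

(** * Root subgroups in a unitary representation *)

Section RootRepresentation.
Variables (B : comNzRingType) (n : nat) (H : hilbertSpace) (pi : 'M[B]_n -> H -> H).
Hypothesis rep : unitary_rep (fun M : 'M[B]_n => \det M = 1) (@mulmx B n n n) 1%:M pi.
Local Notation dot := (@hs_dot H).
Let dotP := hs_inner H.

Definition root_act (W : zmodType) (rho : W -> B) (i j : 'I_n) (w : W) (x : H) : H :=
  pi (elem i j (rho w)) x.

Lemma rep_elemM i j i' j' (a b : B) x : i != j -> i' != j' ->
  pi (elem i j a *m elem i' j' b) x = pi (elem i j a) (pi (elem i' j' b) x).
Proof. by have [_ M _] := rep => ij ij'; apply: M; apply: det_elem. Qed.

Lemma rep_elem_commute (i j k l : 'I_n) (a b : B) x : i != j -> k != l -> j != k -> l != i ->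
  pi (elem i j a) (pi (elem k l b) x) = pi (elem k l b) (pi (elem i j a) x).
Proof. by move=> *; rewrite -!rep_elemM // elem_commute. Qed.

Lemma rep_elem_heisenberg (i j l : 'I_n) (a b : B) x : i != j -> j != l -> i != l ->
  pi (elem i j a) (pi (elem j l b) x) = pi (elem j l b) (pi (elem i l (a * b)) (pi (elem i j a) x)).
Proof.
move=> ij jl il; have ji : j != i by rewrite eq_sym. have li : l != i by rewrite eq_sym.
rewrite (rep_elem_commute (a * b) a x il ij li ji).
have [_ M _] := rep; have dp c d : \det (elem j l c *m elem i j d) = 1.
  by rewrite det_mulmx !det_elem // mulr1.
rewrite -(rep_elemM b a _ jl ij) -[RHS]M //; last exact: det_elem.
by rewrite -elem_heisenberg // rep_elemM.
Qed.

Lemma root_action (W : zmodType) (rho : W -> B) i j :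
  {morph rho : w w' / w + w'} -> i != j -> is_action dot (root_act rho i j).
Proof.
move=> rD ij; have [U M I1] := rep.
have r0 : rho 0 = 0 by apply: (addrI (rho 0)); rewrite -rD !addr0.
split=> [w a u v|w u v|u|w w' u].
- by have [L _ _] := U _ (det_elem (rho w) ij); apply: L.
- by have [_ D _] := U _ (det_elem (rho w) ij); apply: D.
- by rewrite /root_act r0 elem0 I1.
by rewrite /root_act rD -elemD // rep_elemM.
Qed.

Section Pairs.
Variables (p : nat) (iota : 'F_p -> B) (W : finZmodType) (rho : W -> B) (act : 'F_p -> W -> W).
Hypotheses (hp : prime p) (hp5 : (5 <= p)%N).
Hypotheses (iotaD : {morph iota : a b / a + b}) (rhoD : {morph rho : w w' / w + w'}).
Hypothesis rhoZ : forall c w, rho (act c w) = iota c * rho w.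
Hypothesis act_inj : forall c, c != 0 -> injective (act c).
Variables i j l : 'I_n.
Hypotheses (ij : i != j) (jl : j != l) (il : i != l).

Let ji : j != i. Proof. by rewrite eq_sym. Qed.
Let lj : l != j. Proof. by rewrite eq_sym. Qed.
Let li : l != i. Proof. by rewrite eq_sym. Qed.

Lemma pair_scalar_root : pair_ineq dot (heis_cos p)
  (average (root_act iota i j)) (average (root_act rho j l)).
Proof.
(* With the scalar root first, the commutation relation is read backwards, which inverts the central
   term: hence [- c]. *)
apply: (heisenberg_pair_ineq dotP hp hp5 (root_action iotaD ij) (root_action rhoD jl)
  (root_action rhoD il) (act := fun c => act (- c))).
- by move=> c c0; apply: act_inj; rewrite oppr_eq0.
- have i0 : iota 0 = 0 by apply: (addrI (iota 0)); rewrite -iotaD !addr0.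
  have iN c : iota (- c) = - iota c.
    by apply: (addrI (iota c)); rewrite -iotaD !subrr i0.
  move=> c w x; rewrite /root_act rhoZ iN mulNr.
  rewrite (rep_elem_commute _ _ _ il jl) // rep_elem_heisenberg //.
  rewrite (rep_elem_commute _ _ _ ij il) // -(rep_elemM _ _ _ il il) elemD // subrr elem0.
  by have [_ _ I1] := rep; rewrite I1.
- by move=> c w x; apply: rep_elem_commute.
by move=> w w' x; apply: rep_elem_commute.
Qed.

Lemma pair_root_scalar : pair_ineq dot (heis_cos p)
  (average (root_act rho i j)) (average (root_act iota j l)).
Proof.
apply: (pair_ineq_sym dotP).
apply: (heisenberg_pair_ineq dotP hp hp5 (root_action iotaD jl) (root_action rhoD ij)
  (root_action rhoD il) act_inj).
- by move=> c w x; rewrite /root_act rhoZ mulrC; apply: rep_elem_heisenberg.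
- by move=> c w x; apply: rep_elem_commute.
by move=> w w' x; apply: rep_elem_commute.
Qed.

End Pairs.

Lemma root_average_commute (W1 W2 : finZmodType) (r1 : W1 -> B) (r2 : W2 -> B) i j k l x :
  {morph r1 : w w' / w + w'} -> {morph r2 : w w' / w + w'} ->
  i != j -> k != l -> j != k -> l != i ->
  average (root_act r1 i j) (average (root_act r2 k l) x) =
  average (root_act r2 k l) (average (root_act r1 i j) x).
Proof.
move=> D1 D2 ij kl jk li; apply: (average_average_commute dotP); try exact: root_action.
by move=> w w' y; apply: rep_elem_commute.
Qed.

End RootRepresentation.

Section Representation.
Variables (p n k : nat).
Hypotheses (hp : prime p) (hp5 : (5 <= p)%N) (n3 : (3 <= n)%N).
Local Notation R := {mpoly 'F_p[k]}.
Local Notation W := 'rV['F_p]_k.+1.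

Definition affine_form (w : W) : R :=
  (w 0 0)%:MP + \sum_(l < k) (w 0 (lift ord0 l))%:MP * 'X_l.

Definition last_index (i : 'I_n) := i.+1 == n.

(** With the variables on a single edge, every adjacent pair has a scalar root group, as the two
    pair estimates require. *)
Definition gen_coef (i : 'I_n) (w : W) : R :=
  if last_index i then affine_form w else (w 0 0)%:MP.

Definition gens : seq 'M[R]_n :=
  [seq elem i (ordS i) (gen_coef i w) | i <- enum 'I_n, w <- enum {: W}].

Lemma In_mem (T : eqType) (s : seq T) x : List.In x s <-> x \in s.
Proof.
elim: s => //= y s IH; rewrite inE; split=> [[->|/IH ->]|/predU1P[->|/IH h]].
- by rewrite eqxx.
- by rewrite orbT.
- by left.
by right.
Qed.

Lemma gens_mem i w : elem i (ordS i) (gen_coef i w) \in gens.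
Proof. by apply: allpairs_f; rewrite mem_enum. Qed.

Lemma affine_formD : {morph affine_form : w w' / w + w'}.
Proof.
move=> w w'; rewrite /affine_form mxE mpolyCD addrACA -big_split; congr (_ + _).
by apply: eq_bigr => l _; rewrite mxE mpolyCD mulrDl.
Qed.

Lemma affine_formZ c w : affine_form (c *: w) = c%:MP * affine_form w.
Proof.
rewrite /affine_form mxE mpolyCM mulrDr mulr_sumr; congr (_ + _).
by apply: eq_bigr => l _; rewrite mxE mpolyCM mulrA.
Qed.

Lemma gens_generate_El (K : 'M[R]_n -> Prop) :
  K 1%:M -> (forall M N, K M -> K N -> K (M *m N)) -> (forall g, g \in gens -> K g) ->
  forall M, El (@all_in R) M -> K M.
Proof.
move=> K1 KM Kg; have n0 : (0 < n)%N by apply: leq_trans n3.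
apply: (gens_generate hp n3 K1 KM) => [i|].
  have -> : 1 = gen_coef i (\row_j (j == 0)%:R).
    rewrite /gen_coef /affine_form big1 => [|l _]; last by rewrite mxE mpolyC0 mul0r.
    by rewrite mxE addr0; case: ifP.
  exact: Kg (gens_mem _ _).
have nn : (n.-1 < n)%N by rewrite prednK.
exists (Ordinal nn) => l.
have -> : 'X_l = gen_coef (Ordinal nn) (\row_j (j == lift ord0 l)%:R).
  rewrite /gen_coef /last_index /= prednK // eqxx /affine_form (bigD1 l) //= big1 => [|m ml].
    by rewrite !mxE eqxx mpolyC0 mpolyC1 mul1r add0r addr0.
  by rewrite mxE (inj_eq lift_inj) (negPf ml) mpolyC0 mul0r.
exact: Kg (gens_mem _ _).
Qed.

Lemma gens_generate_SL : generates (@inSL p n k) (@mulmx R n n n) 1%:M (@invmx R n) gens.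
Proof.
split=> [s /In_mem|g dg].
  by case/allpairsP => -[i w] [_ _ ->]; apply: det_elem; apply: ordS_neq; apply: ltnW.
pose K (M : 'M[R]_n) := exists w : seq (bool * 'M[R]_n),
  (forall x, List.In x w -> List.In x.2 gens) /\
  M = List.fold_right (fun x acc => (if x.1 then x.2 else invmx x.2) *m acc) 1%:M w.
suff : K g by [].
apply: gens_generate_El (suslin_mpoly n3 dg) => [|M N [w [Hw ->]] [w' [Hw' ->]]|h hg].
- by exists [::].
- exists (w ++ w'); split.
    by move=> x /List.in_app_iff [/Hw|/Hw'].
  elim: w {Hw} => [|x w IH] /=; first by rewrite mul1mx.
  by rewrite -IH mulmxA.
exists [:: (true, h)]; split=> /= [x [<-|//]|]; first exact/In_mem.
by rewrite mulmx1.
Qed.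

Variables (H : hilbertSpace) (pi : 'M[R]_n -> H -> H).
Hypothesis rep : unitary_rep (@inSL p n k) (@mulmx R n n n) 1%:M pi.
Local Notation dot := (@hs_dot H).
Let dotP := hs_inner H.

Let polyCD : {morph @mpolyC k 'F_p : a b / a + b}.
Proof. by move=> a b; rewrite mpolyCD. Qed.

Definition root_proj (i : 'I_n) : H -> H :=
  if last_index i then average (root_act pi affine_form i (ordS i))
  else average (root_act pi (@mpolyC k 'F_p) i (ordS i)).

Let n2 : (1 < n)%N. Proof. exact: ltnW. Qed.

Lemma root_proj_orthoproj i : is_orthoproj dot (root_proj i).
Proof.
have iS := ordS_neq i n2; rewrite /root_proj; case: (last_index i).
  exact: (average_proj dotP (root_action rep affine_formD iS)).
exact: (average_proj dotP (root_action rep polyCD iS)).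
Qed.

Lemma root_proj_adjacent i : pair_ineq dot (heis_cos p) (root_proj i) (root_proj (ordS i)).
Proof.
have iS := ordS_neq i n2; have SS := ordS_neq (ordS i) n2; have iSS := ordSS_neq i n3.
have inj_scale (c : 'F_p) : c != 0 -> injective (fun w : W => c *: w) by move=> c0; apply: scalerI.
have inj_mul (c : 'F_p) : c != 0 -> injective (fun w : 'F_p => c * w) by move=> c0; apply: mulfI.
have mulC (c w : 'F_p) : (c * w)%:MP = c%:MP * w%:MP :> R by rewrite mpolyCM.
rewrite /root_proj; case li : (last_index i); case lS : (last_index (ordS i)).
- move: li lS; rewrite /last_index => /eqP li.
  have -> : nat_of_ord (ordS i) = if (i.+1 < n)%N then i.+1 else 0 := val_ordS i.
  by rewrite li ltnn => /eqP e; exfalso; move: n3; rewrite -e.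
- exact: (pair_root_scalar rep hp hp5 polyCD affine_formD affine_formZ inj_scale iS SS iSS).
- exact: (pair_scalar_root rep hp hp5 polyCD affine_formD affine_formZ inj_scale iS SS iSS).
exact: (pair_scalar_root rep hp hp5 polyCD polyCD mulC inj_mul iS SS iSS).
Qed.

Lemma root_proj_far i j x : i != j -> j != ordS i -> i != ordS j ->
  0 <= ip dot (x - root_proj i x) (x - root_proj j x).
Proof.
move=> ij jS iS; apply: (proj_comm_ge0 dotP); [exact: root_proj_orthoproj|exact: root_proj_orthoproj|].
have iS' := ordS_neq i n2; have jS' := ordS_neq j n2.
have Si : ordS i != j by rewrite eq_sym.
have Sj : ordS j != i by rewrite eq_sym.
rewrite /root_proj; case: (last_index i); case: (last_index j).
- exact: (root_average_commute rep x affine_formD affine_formD iS' jS' Si Sj).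
- exact: (root_average_commute rep x affine_formD polyCD iS' jS' Si Sj).
- exact: (root_average_commute rep x polyCD affine_formD iS' jS' Si Sj).
exact: (root_average_commute rep x polyCD polyCD iS' jS' Si Sj).
Qed.

Definition heis_gap : RR := 1 - 2 * heis_cos p.

Lemma heis_gap_gt0 : 0 < heis_gap.
Proof. by rewrite subr_gt0 heis_cos_lt. Qed.

Lemma heis_gap_le1 : heis_gap <= 1.
Proof. by rewrite lerBlDr lerDl mulr_ge0 // ltW // heis_cos_gt0. Qed.

(* An ordered pair contributes to the square of the Laplacian at least [-c/2] times the two
   diagonal terms when adjacent, and a nonnegative amount otherwise; every index has two
   neighbours. *)
Lemma laplacian_gap (x : H) :
  heis_gap * (\sum_i ip dot (x - root_proj i x) (x - root_proj i x)) <=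
  ip dot (\sum_i (x - root_proj i x)) (\sum_i (x - root_proj i x)).
Proof.
pose Q i := x - root_proj i x; pose q i := ip dot (Q i) (Q i); pose c := heis_cos p.
have c0 : 0 < c by apply: heis_cos_gt0.
have q0 i : 0 <= q i by apply: ip_ge0 dotP _.
have lower i j : 2 * (q i *+ (i == j)) - c * ((q i + q j) *+ (j == ordS i) + (q i + q j) *+ (i == ordS j)) <=
    2 * ip dot (Q i) (Q j).
  have [<-|ij] := eqVneq i j.
    by rewrite (negPf (ordS_neq i n2)) addr0 mulr0 subr0.
  have [->|jS] := eqVneq j (ordS i).
    rewrite (negPf (ordSS_neq i n3)) addr0 mulr0n mulr0 sub0r -mulNr.
    exact: root_proj_adjacent.
  have [->|iS] := eqVneq i (ordS j).
    rewrite mulr0n mulr0 sub0r add0r -mulNr; exact: (pair_ineq_sym dotP (root_proj_adjacent j)).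
  by rewrite !mulr0n addr0 !mulr0 subr0 mulr_ge0 // root_proj_far.
have sumS (F : 'I_n -> RR) : \sum_i F (ordS i) = \sum_i F i.
  by rewrite [RHS](reindex_inj (@ordS_inj n)).
have sum1 (F : 'I_n -> RR) j : \sum_i (F i *+ (i == j)) = F j.
  by rewrite (bigD1 j) //= eqxx big1 ?addr0 // => i /negPf ->.
rewrite (ip_suml dotP) -/(\sum_i q i).
have -> : \sum_i ip dot (x - root_proj i x) (\sum_i0 (x - root_proj i0 x)) = \sum_i \sum_j ip dot (Q i) (Q j).
  by apply: eq_bigr => i _; rewrite (ip_sumr dotP).
rewrite -(ler_pM2l (x := 2)) // [leRHS]mulr_sumr.
have -> : \sum_i 2 * (\sum_j ip dot (Q i) (Q j)) = \sum_i \sum_j 2 * ip dot (Q i) (Q j).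
  by apply: eq_bigr => i _; rewrite mulr_sumr.
apply: le_trans (ler_sum _ (fun i _ => ler_sum _ (fun j _ => lower i j))).
have lin (X Y Z : 'I_n -> 'I_n -> RR) : \sum_i \sum_j (2 * X i j - c * (Y i j + Z i j)) =
    2 * (\sum_i \sum_j X i j) - c * (\sum_i \sum_j Y i j + \sum_i \sum_j Z i j).
  rewrite mulr_sumr -big_split /= mulr_sumr -sumrB; apply: eq_bigr => i _.
  by rewrite mulr_sumr -big_split /= mulr_sumr -sumrB.
rewrite lin; have sS := sumS q; clear lower q0 sumS; clearbody q.
have -> : \sum_i \sum_j q i *+ (i == j) = \sum_i q i.
  by apply: eq_bigr => i _; under eq_bigr do rewrite eq_sym; apply: sum1.
have -> : \sum_i \sum_j (q i + q j) *+ (j == ordS i) = \sum_i (q i + q (ordS i)).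
  by apply: eq_bigr => i _; apply: (sum1 (fun j => q i + q j)).
have -> : \sum_i \sum_j (q i + q j) *+ (i == ordS j) = \sum_i (q (ordS i) + q i).
  by rewrite exchange_big; apply: eq_bigr => j _; apply: (sum1 (fun i => q i + q j)).
(* Each of the two neighbour sums equals twice the sum of [q], so the total is [2 - 4 c] times that
   sum. *)
by rewrite !big_split /= !sS /heis_gap -/c le_eqVlt; apply/orP; left; apply/eqP; ring.
Qed.

(** Each projection moves [v] by at most [e], so the square root of the energy is at most [n e],
    which is [(1 - s) / 2] by the choice of [e]. Descent then ends at a [w] within [1/2] of the unit
    vector [v], hence nonzero; being fixed by all root projections, it is fixed by the
    generators. *)
Lemma small_displacement_invariant (v : H) : hnorm v = 1 ->
  (forall g, g \in gens -> hnorm (pi g v - v) <=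
     (1 - Num.sqrt (1 - heis_gap / n%:R)) / (2 * n%:R)) ->
  exists w : H, w <> 0 /\ forall g, inSL g -> pi g w = w.
Proof.
move=> v1 Hv; set s := Num.sqrt _ in Hv; set e := _ / _ in Hv.
have n0 : (0 < n)%N by apply: ltnW.
have nR : 0 < n%:R :> RR by rewrite ltr0n.
have nR1 : 1 <= n%:R :> RR by rewrite ler1n.
have d0 := heis_gap_gt0; have d1 := heis_gap_le1.
have s1 : s < 1.
  by rewrite -sqrtr1 ltr_sqrt // ltrBlDr ltrDl divr_gt0.
have e0 : 0 <= e by rewrite divr_ge0 ?subr_ge0 ?mulr_ge0 // ltW.
have card0 : (0 < #|'I_n|)%N by rewrite card_ord.
have [w [Pw]] := gradient_descent dotP (@hs_complete H) root_proj_orthoproj d0 d1 card0 laplacian_gap v.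
rewrite card_ord -/s => dist.
have near i : ip_norm dot (v - root_proj i v) <= e.
  rewrite /root_proj; case li : (last_index i); apply: (average_near dotP) => x.
    by have := Hv _ (gens_mem i x); rewrite /gen_coef li.
  by have := Hv _ (gens_mem i (\row__ x)); rewrite /gen_coef li mxE.
have fle : Num.sqrt (\sum_i ip dot (v - root_proj i v) (v - root_proj i v)) <= n%:R * e.
  have ne0 : 0 <= n%:R * e by rewrite mulr_ge0.
  rewrite -[leRHS](ger0_norm ne0) -sqrtr_sqr; apply: ler_wsqrtr.
  apply: (@le_trans _ _ (\sum_(i < n) e ^+ 2)).
    apply: ler_sum => i _; rewrite -(ip_norm_sqr dotP).
    by rewrite ler_pXn2r ?nnegrE ?ip_norm_ge0.
  rewrite sumr_const card_ord -[e ^+ 2 *+ n]mulr_natl [(n%:R * e) ^+ 2]exprMn; apply: ler_wpM2r; first exact: sqr_ge0.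
  by rewrite -[leLHS]mulr1 [_ ^+ 2]expr2 ler_pM2l.
have half : (1 - s) * ip_norm dot (v - w) <= (1 - s) * 2^-1.
  apply: le_trans dist _; apply: le_trans fle _.
  rewrite /e le_eqVlt; apply/orP; left; apply/eqP; field.
  by rewrite gt_eqF.
rewrite ler_pM2l ?subr_gt0 // in half.
exists w; split.
  move=> w0; move: half; rewrite w0 subr0 -[ip_norm dot v]/(hnorm v) v1; lra.
have [_ M I1] := rep.
pose K (g : 'M[R]_n) := inSL g /\ pi g w = w.
move=> g dg; suff : K g by case.
apply: gens_generate_El (suslin_mpoly n3 dg) => [|M1 M2 [d1' f1] [d2' f2]|h hg].
- by split; [apply: det1|apply: I1].
- by split; [rewrite /inSL det_mulmx d1' d2' mulr1|rewrite M // f2].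
case/allpairsP: hg => -[i x] [_ _ ->] /=; have iS := ordS_neq i n2.
split; first exact: det_elem.
rewrite -(Pw i) /root_proj /gen_coef; case: (last_index i).
  exact: (act_average (root_action rep affine_formD iS)).
exact: (act_average (root_action rep polyCD iS)).
Qed.

End Representation.

Theorem theorem1p4 (p n k : nat) (hp : prime p) (hp5 : (5 <= p)%N) (hn : (3 <= n)%N) :
  property_T (@inSL p n k) (@mulmx {mpoly 'F_p[k]} n n n) (1%:M)
    (@invmx {mpoly 'F_p[k]} n).
Proof.
exists (gens p n k); split; first exact: gens_generate_SL.
exists ((1 - Num.sqrt (1 - heis_gap p / n%:R)) / (2 * n%:R)); split.
  have n0 : 0 < n%:R :> RR by rewrite ltr0n; apply: ltnW; apply: ltnW.
  rewrite divr_gt0 ?mulr_gt0 // subr_gt0 -[ltRHS]sqrtr1 ltr_sqrt // ltrBlDr ltrDl.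
  by rewrite divr_gt0 // heis_gap_gt0.
move=> H pi rep v v1 Hv; apply: (small_displacement_invariant hp hp5 hn rep v1) => g gg.
by apply: Hv; apply/In_mem.
Qed.
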